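(* Let $B:\Sigma^*\to\Sigma^*$ be a limit computable function. There is a constant $c$ depending only on $B$ such that for all $x,y\in\Sigma^*$, $$\mathbf{I}(B(x):y) < \mathbf{I}(x:y)+\mathbf{I}(\langle x,y\rangle;\mathcal{H})+c.$$
   Context: $\Sigma=\{0,1\}$, $\Sigma^*$ the finite binary strings, $\perp$ the empty string. $\mathbf{K}(x\mid z)$ is prefix Kolmogorov complexity relative to auxiliary input $z$ (finite string or infinite sequence) with respect to a fixed universal prefix-free machine $U_z$; $\mathbf{K}(x)=\mathbf{K}(x\mid\perp)$. $\langle x,y\rangle$ is a fixed computable encoding of the pair $(x,y)$ as a string and $\mathbf{K}(x,y)=\mathbf{K}(\langle x,y\rangle)$. The symmetric algorithmic mutual information is $\mathbf{I}(x:y)=\mathbf{K}(x)+\mathbf{K}(y)-\mathbf{K}(x,y)$. $\mathcal{H}$ is the halting sequence (characteristic sequence of the domain of $U$), and for a string $w$, $\mathbf{I}(w;\mathcal{H})=\mathbf{K}(w)-\mathbf{K}(w\mid\mathcal{H})$. A function $B:\Sigma^*\to\Sigma^*$ is limit computable if some Turing machine $T$, whenever $B(x)\ne\perp$, on input $x$ eventually writes $B(x)$ on its output tape and never changes it afterward (halting or not); when $B(x)=\perp$, $T$ eventually outputs nothing or changes its output forever. *)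

(* Defs.v *)
(* A self-contained model of (oracle) computability:
   unary mu-recursive codes over nat with Cantor pairing, plus an oracle
   primitive.  Binary strings are [list bool], identified with nat through
   the bijection [nat_of_str]. *)
From Stdlib Require Import Arith List ZArith ClassicalEpsilon.
Import ListNotations.

Definition cp (a b : nat) : nat := (a + b) * S (a + b) / 2 + b.

(* ---------- strings <-> nat (length-first bijection) ---------- *)
Fixpoint nat_of_str (s : list bool) : nat :=
  match s with
  | [] => 0
  | b :: s' => S ((if b then 1 else 0) + 2 * nat_of_str s')
  end.

Inductive code : Type :=
| CZero : code
| CSucc : code
| CId   : code
| CFst  : code
| CSnd  : code
| CPair : code -> code -> code
| CComp : code -> code -> code
| CRec  : code -> code -> code
| CMin  : code -> code
| COracle : code.

Inductive ev (O : nat -> bool) : code -> nat -> nat -> Prop :=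
| ev_zero x : ev O CZero x 0
| ev_succ x : ev O CSucc x (S x)
| ev_id x : ev O CId x x
| ev_fst a b : ev O CFst (cp a b) a
| ev_snd a b : ev O CSnd (cp a b) b
| ev_pair f g x a b : ev O f x a -> ev O g x b -> ev O (CPair f g) x (cp a b)
| ev_comp f g x y z : ev O g x y -> ev O f y z -> ev O (CComp f g) x z
| ev_rec0 f g x y : ev O f x y -> ev O (CRec f g) (cp 0 x) y
| ev_recS f g n x r y :
    ev O (CRec f g) (cp n x) r -> ev O g (cp n (cp r x)) y ->
    ev O (CRec f g) (cp (S n) x) y
| ev_min f x n :
    (forall m, m < n -> exists k, ev O f (cp m x) (S k)) ->
    ev O f (cp n x) 0 -> ev O (CMin f) x n
| ev_oracle x : ev O COracle x (if O x then 1 else 0).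

Definition run (e : code) (O : nat -> bool) (p x : list bool) : Prop :=
  ev O e (nat_of_str p) (nat_of_str x).

Definition halts (e : code) (O : nat -> bool) (p : list bool) : Prop :=
  exists x, run e O p x.

Definition is_prefix (p q : list bool) : Prop := exists r, q = p ++ r.

Definition prefix_free (e : code) : Prop :=
  forall O p q, halts e O p -> halts e O q -> is_prefix p q -> p = q.

Definition universal_pf (u : code) : Prop :=
  prefix_free u /\
  forall e, prefix_free e -> exists c, forall O p x,
    run e O p x -> exists q, run u O q x /\ length q <= length p + c.

Definition no_aux : nat -> bool := fun _ => false.

Definition Kc (u : code) (O : nat -> bool) (x : list bool) : nat :=
  epsilon (inhabits 0) (fun n =>
    (exists p, length p = n /\ run u O p x) /\
    (forall p, run u O p x -> n <= length p)).

Definition K (u : code) (x : list bool) : nat := Kc u no_aux x.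

Definition pair_str (x y : list bool) : list bool :=
  flat_map (fun b => [b; b]) x ++ [false; true] ++ y.

Definition Imut (u : code) (x y : list bool) : Z :=
  (Z.of_nat (K u x) + Z.of_nat (K u y) - Z.of_nat (K u (pair_str x y)))%Z.

(* halting sequence: characteristic sequence of the domain of U (= U_perp),
   strings indexed by nat_of_str *)
Definition halting_seq (u : code) : nat -> bool := fun n =>
  if excluded_middle_informative (exists y, ev no_aux u n y) then true else false.

Definition IH (u : code) (w : list bool) : Z :=
  (Z.of_nat (K u w) - Z.of_nat (Kc u (halting_seq u) w))%Z.

(* limit computability: T's output tape at time t on input x is given by a
   total computable g(<x,t>) *)
Definition out (g : code) (x : list bool) (t : nat) (y : list bool) : Prop :=
  ev no_aux g (cp (nat_of_str x) t) (nat_of_str y).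

Definition limit_computable (B : list bool -> list bool) : Prop :=
  exists g : code,
    (forall x t, exists y, out g x t y) /\
    forall x,
      (B x <> [] -> exists t0, forall t, t0 <= t -> out g x t (B x)) /\
      (B x = [] ->
         (exists t0, forall t, t0 <= t -> out g x t []) \/
         (forall t0, exists t y y0,
            t0 <= t /\ out g x t y /\ out g x t0 y0 /\ y <> y0)).

(* Main.v *)
(* After cancellation the claim reads K(x,y|H) + K(z) <= K(x) + K(z,y) + O(1) for z = B(x).
   Given H, a shortest program of x yields x, hence z as a limit, and then
   K(z) and all the numbers K(z,y); so it remains to describe y given z, with H, by
   K(z,y) - K(z) + O(1) further bits.  As these lengths are computable from H, a
   Kraft-Chaitin code does this, provided that the sum over y of 2^(-K(z,y)) is at most
   O(2^(-K(z))).  This is the coding theorem for the marginal of 2^(-|p|) on first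
   components of outputs, obtained from a second, oracle-free Kraft-Chaitin code.
   Machines have to be prefix-free for every oracle, so the codewords are cut out of
   consecutive intervals, which are disjoint whatever lengths are requested.
   That H decides such limits follows from the optimality of u alone: the least witness of
   a decidable property of n is printed by a program of length n + O(1). *)
Require Import Defs.
From Stdlib Require Import Arith List ZArith ClassicalEpsilon.
From Stdlib Require Import Reals Lra Lia Bool.
Import ListNotations.

Local Open Scope nat_scope.

(** * Pairing and strings as numbers *)

(** In the chain rule the excess of K(z,y) over K(z) describes y only if K(z) is known besides z;
    here H supplies it, so no logarithmic term is lost. K(x,y) cancels between I(x:y) and
    I(<x,y>;H), so that the oracle occurs in a single complexity, that of the pair to be described,
    and all the others are unconditional. The obstacle is prefix-freeness under oracles other than
    H, where limits may be wrong and request lengths undefined. Therefore the decoder accepts an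
    arbitrary partial request code with a parameter, and its prefix-freeness rests on determinism
    and on the geometry of intervals. The program of x is simulated without oracle, so that it ends
    at the same place under every oracle; x, and then the parameter z, are fixed before the codeword
    of y is read, although z is never written down. *)

Lemma cp_0_S (b : nat) : cp (S b) 0 = S (cp 0 b).
Proof.
unfold cp. rewrite !Nat.add_0_r, !Nat.add_0_l.
replace (S b * S (S b)) with (b * S b + S b * 2) by lia.
rewrite Nat.div_add by lia. lia.
Qed.

Lemma cp_S_r (a b : nat) : cp a (S b) = S (cp (S a) b).
Proof. unfold cp. replace (a + S b) with (S a + b) by lia. lia. Qed.

(** Walks along the diagonals in the order of [cp], so that inverting [cp] takes no square roots. *)
Fixpoint unpair (n : nat) : nat * nat :=
  match n with
  | 0 => (0, 0)
  | S n => match unpair n with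
           | (0, b) => (S b, 0)
           | (S a, b) => (a, S b)
           end
  end.

Definition p1 (n : nat) : nat := fst (unpair n).
Definition p2 (n : nat) : nat := snd (unpair n).

Lemma unpair_cp (a b : nat) : unpair (cp a b) = (a, b).
Proof.
remember (cp a b) as n eqn:Hn. revert a b Hn.
induction n as [|n IH]; intros a b Hn.
- destruct b as [|b]; [|rewrite cp_S_r in Hn; discriminate].
  destruct a as [|a]; [reflexivity|rewrite cp_0_S in Hn; discriminate].
- destruct b as [|b].
  + destruct a as [|a]; [discriminate|].
    rewrite cp_0_S in Hn. injection Hn as Hn. simpl. now rewrite (IH _ _ Hn).
  + rewrite cp_S_r in Hn. injection Hn as Hn. simpl. now rewrite (IH _ _ Hn).
Qed.

Lemma p1_cp (a b : nat) : p1 (cp a b) = a.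
Proof. unfold p1. now rewrite unpair_cp. Qed.

Lemma p2_cp (a b : nat) : p2 (cp a b) = b.
Proof. unfold p2. now rewrite unpair_cp. Qed.

Lemma cp_p1_p2 (n : nat) : cp (p1 n) (p2 n) = n.
Proof.
unfold p1, p2. induction n as [|n IH]; [reflexivity|]. simpl.
destruct (unpair n) as [[|a] b]; simpl in *.
- now rewrite cp_0_S, IH.
- now rewrite cp_S_r, IH.
Qed.

Lemma cp_inj (a b c d : nat) : cp a b = cp c d -> a = c /\ b = d.
Proof.
intros H. split; [rewrite <- (p1_cp a b), H; apply p1_cp
                 |rewrite <- (p2_cp a b), H; apply p2_cp].
Qed.

Lemma p1_le (n : nat) : p1 n <= n.
Proof. rewrite <- (cp_p1_p2 n) at 2. unfold cp. rewrite Nat.add_comm.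
set (a := p1 n). set (b := p2 n).
enough (a + b <= (a + b) * S (a + b) / 2) by lia.
destruct (a + b) as [|m]; [apply Nat.le_0_l|].
apply Nat.div_le_lower_bound; nia.
Qed.

Lemma p2_le (n : nat) : p2 n <= n.
Proof. rewrite <- (cp_p1_p2 n) at 2. unfold cp. lia. Qed.

(** Increment in bijective base two, least significant digit first, with [false] and [true] as the
    digits 1 and 2. *)
Fixpoint str_succ (s : list bool) : list bool :=
  match s with
  | [] => [false]
  | false :: s => true :: s
  | true :: s => false :: str_succ s
  end.

Definition str (n : nat) : list bool := Nat.iter n str_succ [].

Lemma nat_of_str_succ (s : list bool) : nat_of_str (str_succ s) = S (nat_of_str s).
Proof. induction s as [|[] s IH]; simpl; lia. Qed.

Lemma nat_of_strK (n : nat) : nat_of_str (str n) = n.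
Proof.
induction n as [|n IH]; [reflexivity|].
change (str (S n)) with (str_succ (str n)). now rewrite nat_of_str_succ, IH.
Qed.

Lemma nat_of_str_inj (s s' : list bool) : nat_of_str s = nat_of_str s' -> s = s'.
Proof.
revert s'. induction s as [|b s IH]; intros [|b' s'] H; simpl in H;
  [reflexivity|lia|lia|].
destruct b, b'; try lia; f_equal; apply IH; lia.
Qed.

Lemma strK (s : list bool) : str (nat_of_str s) = s.
Proof. apply nat_of_str_inj, nat_of_strK. Qed.

Lemma str_cons (b : bool) (n : nat) : str (S (Nat.b2n b + 2 * n)) = b :: str n.
Proof.
apply nat_of_str_inj. rewrite nat_of_strK. simpl. rewrite nat_of_strK. now destruct b.
Qed.

Lemma nat_of_str_app (s s' : list bool) :
  nat_of_str (s ++ s') = nat_of_str s + 2 ^ length s * nat_of_str s'.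
Proof. induction s as [|b s IH]; simpl; [lia|]. rewrite IH. destruct b; simpl; lia. Qed.

Lemma length_str_bounds (s : list bool) :
  2 ^ length s <= S (nat_of_str s) < 2 * 2 ^ length s.
Proof. induction s as [|[] s IH]; simpl in *; lia. Qed.

Lemma length_str_mono (m n : nat) : m <= n -> length (str m) <= length (str n).
Proof.
intros H. destruct (le_lt_dec (length (str m)) (length (str n))) as [|Hlt]; [easy|].
pose proof (length_str_bounds (str m)) as Hm.
pose proof (length_str_bounds (str n)) as Hn.
rewrite nat_of_strK in Hm, Hn.
assert (2 ^ S (length (str n)) <= 2 ^ length (str m)) by (apply Nat.pow_le_mono_r; lia).
simpl in *. lia.
Qed.

Lemma length_str_le (n : nat) : length (str n) <= n.
Proof.
pose proof (length_str_bounds (str n)) as H. rewrite nat_of_strK in H.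
pose proof (Nat.pow_gt_lin_r 2 (length (str n))). lia.
Qed.

(** * Functions computed by codes *)

(** One code has to serve every oracle in [Q]. Later [Q] is [all_oracles] for plain computability,
    or [halting u] for computability from the halting sequence. *)
Definition comp (Q : (nat -> bool) -> Prop) (f : nat -> nat) : Prop :=
  exists e, forall O, Q O -> forall x, ev O e x (f x).

Lemma comp_ext Q f g : (forall x, f x = g x) -> comp Q f -> comp Q g.
Proof. intros H [e He]. exists e. intros O HO x. rewrite <- H. auto. Qed.

Lemma comp_id Q : comp Q (fun x => x).
Proof. exists CId. intros. apply ev_id. Qed.

Lemma comp_comp Q f g : comp Q f -> comp Q g -> comp Q (fun x => f (g x)).
Proof. intros [e He] [d Hd]. exists (CComp e d). intros. eapply ev_comp; eauto. Qed.

Lemma comp_S Q f : comp Q f -> comp Q (fun x => S (f x)).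
Proof.
intros Hf. apply (comp_comp Q S f); [|exact Hf]. exists CSucc. intros. apply ev_succ.
Qed.

Lemma comp_const Q n : comp Q (fun _ => n).
Proof.
induction n as [|n IH]; [exists CZero; intros; apply ev_zero|].
now apply (comp_S Q (fun _ => n)).
Qed.

Lemma comp_p1 Q f : comp Q f -> comp Q (fun x => p1 (f x)).
Proof.
intros Hf. apply (comp_comp Q p1 f); [|exact Hf]. exists CFst. intros O _ x.
rewrite <- (cp_p1_p2 x) at 1. apply ev_fst.
Qed.

Lemma comp_p2 Q f : comp Q f -> comp Q (fun x => p2 (f x)).
Proof.
intros Hf. apply (comp_comp Q p2 f); [|exact Hf]. exists CSnd. intros O _ x.
rewrite <- (cp_p1_p2 x) at 1. apply ev_snd.
Qed.

Lemma comp_cp Q f g : comp Q f -> comp Q g -> comp Q (fun x => cp (f x) (g x)).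
Proof. intros [e He] [d Hd]. exists (CPair e d). intros. apply ev_pair; auto. Qed.

Lemma comp_comp2 Q (f : nat -> nat -> nat) g h :
  comp Q (fun w => f (p1 w) (p2 w)) -> comp Q g -> comp Q h ->
  comp Q (fun x => f (g x) (h x)).
Proof.
intros Hf Hg Hh.
eapply comp_ext; [|apply (comp_comp Q _ _ Hf (comp_cp Q _ _ Hg Hh))].
intros x. simpl. now rewrite p1_cp, p2_cp.
Qed.

Definition compb (Q : (nat -> bool) -> Prop) (b : nat -> bool) : Prop :=
  comp Q (fun x => Nat.b2n (b x)).

(* The hooks are redefined as more closure lemmas become available. *)
Ltac comp_hook := fail.
Ltac comp_hook2 := fail.
Ltac comp_step :=
  match goal with
  | H : _ |- _ => exact H
  | |- comp _ (fun _ => ?n) => apply comp_const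
  | |- comp _ (fun x => x) => apply comp_id
  | |- comp ?Q p1 => apply (comp_p1 Q (fun x => x))
  | |- comp ?Q p2 => apply (comp_p2 Q (fun x => x))
  | |- comp _ (fun x => S (@?f x)) => apply (comp_S _ f)
  | |- comp _ (fun x => p1 (@?f x)) => apply (comp_p1 _ f)
  | |- comp _ (fun x => p2 (@?f x)) => apply (comp_p2 _ f)
  | |- comp _ (fun x => cp (@?f x) (@?g x)) => apply (comp_cp _ f g)
  | _ => comp_hook
  | _ => comp_hook2
  | H : comp ?Q ?f |- comp ?Q (fun x => ?f (@?g x)) => apply (comp_comp Q f g)
  | H : comp ?Q (fun w => ?f (p1 w) (p2 w)) |- comp ?Q (fun x => ?f (@?g x) (@?h x)) =>
      apply (comp_comp2 Q f g h H)
  | H : compb ?Q (fun w => ?f (p1 w) (p2 w)) |- compb ?Q (fun x => ?f (@?g x) (@?h x)) =>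
      apply (comp_comp2 Q (fun a b => Nat.b2n (f a b)) g h H)
  end.
Ltac comp := repeat comp_step.

Lemma comp_rec Q (s : nat -> nat -> nat -> nat) n a :
  comp Q (fun w => s (p1 w) (p1 (p2 w)) (p2 (p2 w))) -> comp Q n -> comp Q a ->
  comp Q (fun x => nat_rec _ (a x) (fun i r => s i r x) (n x)).
Proof.
intros [es Hs] Hn [ea Ha].
assert (H : comp Q (fun w => nat_rec (fun _ => nat) (a (p2 w)) (fun i r => s i r (p2 w)) (p1 w))).
{ exists (CRec ea es). intros O HO w. rewrite <- (cp_p1_p2 w) at 1.
  induction (p1 w) as [|i IH]; simpl; [apply ev_rec0; auto|].
  eapply ev_recS; [exact IH|].
  set (r := nat_rec _ _ _ i).
  specialize (Hs O HO (cp i (cp r (p2 w)))). now rewrite !p2_cp, !p1_cp in Hs. }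
pose proof (comp_comp Q _ _ H (comp_cp Q _ _ Hn (comp_id Q))) as H'.
eapply comp_ext; [|exact H']. intros x. simpl. now rewrite p2_cp, p1_cp.
Qed.

Lemma comp_add Q f g : comp Q f -> comp Q g -> comp Q (fun x => f x + g x).
Proof.
intros Hf Hg.
eapply comp_ext; [|apply (comp_rec Q (fun _ r _ => S r) f g); comp].
intros x. simpl. induction (f x); simpl; auto.
Qed.

Lemma comp_mul Q f g : comp Q f -> comp Q g -> comp Q (fun x => f x * g x).
Proof.
intros Hf Hg.
eapply comp_ext;
  [|apply (comp_rec Q (fun _ r x => g x + r) f (fun _ => 0)); comp].
- intros x. simpl. induction (f x); simpl; auto.
- apply comp_add; comp.
Qed.

Lemma comp_pred Q f : comp Q f -> comp Q (fun x => pred (f x)).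
Proof.
intros Hf.
eapply comp_ext; [|apply (comp_rec Q (fun i _ _ => i) f (fun _ => 0)); comp].
intros x. simpl. now destruct (f x).
Qed.

Lemma comp_sub Q f g : comp Q f -> comp Q g -> comp Q (fun x => f x - g x).
Proof.
intros Hf Hg.
eapply comp_ext; [|apply (comp_rec Q (fun _ r _ => pred r) g f); comp].
- intros x. simpl. induction (g x) as [|n IH]; simpl; [lia|]. rewrite IH. lia.
- apply comp_pred; comp.
Qed.

Lemma comp_pow2 Q f : comp Q f -> comp Q (fun x => 2 ^ f x).
Proof.
intros Hf.
eapply comp_ext; [|apply (comp_rec Q (fun _ r _ => 2 * r) f (fun _ => 1)); comp].
- intros x. simpl. induction (f x) as [|n IH]; simpl; [lia|]. rewrite IH. lia.
- apply comp_mul; comp.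
Qed.

Lemma comp_if Q b f g :
  compb Q b -> comp Q f -> comp Q g -> comp Q (fun x => if b x then f x else g x).
Proof.
intros Hb Hf Hg.
eapply comp_ext;
  [|apply (comp_add Q (fun x => Nat.b2n (b x) * f x) (fun x => (1 - Nat.b2n (b x)) * g x))].
- intros x. simpl. destruct (b x); simpl; lia.
- now apply comp_mul.
- apply comp_mul; [|exact Hg]. apply comp_sub; comp.
Qed.

Lemma compb_leb Q f g : comp Q f -> comp Q g -> compb Q (fun x => f x <=? g x).
Proof.
intros Hf Hg. unfold compb.
eapply comp_ext; [|apply (comp_sub Q (fun _ => 1) (fun x => f x - g x)); comp].
- intros x. cbv beta. destruct (Nat.leb_spec (f x) (g x)); cbn [Nat.b2n]; lia.
- now apply comp_sub.
Qed.

Lemma compb_negb Q b : compb Q b -> compb Q (fun x => negb (b x)).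
Proof.
intros Hb. unfold compb. eapply comp_ext; [|apply (comp_if Q b (fun _ => 0) (fun _ => 1)); comp].
intros x. simpl. now destruct (b x).
Qed.

Lemma compb_andb Q b c : compb Q b -> compb Q c -> compb Q (fun x => b x && c x).
Proof.
intros Hb Hc. unfold compb.
eapply comp_ext; [|apply (comp_if Q b (fun x => Nat.b2n (c x)) (fun _ => 0)); comp].
intros x. simpl. now destruct (b x).
Qed.

Lemma compb_orb Q b c : compb Q b -> compb Q c -> compb Q (fun x => b x || c x).
Proof.
intros Hb Hc. unfold compb.
eapply comp_ext; [|apply (comp_if Q b (fun _ => 1) (fun x => Nat.b2n (c x))); comp].
intros x. simpl. now destruct (b x).
Qed.

Lemma compb_eqb Q f g : comp Q f -> comp Q g -> compb Q (fun x => f x =? g x).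
Proof.
intros Hf Hg. unfold compb.
eapply comp_ext;
  [|apply (compb_andb Q (fun x => f x <=? g x) (fun x => g x <=? f x)); now apply compb_leb].
intros x. simpl. f_equal.
destruct (Nat.eqb_spec (f x) (g x)) as [->|H]; [now rewrite Nat.leb_refl|].
destruct (Nat.leb_spec (f x) (g x)), (Nat.leb_spec (g x) (f x)); simpl; try reflexivity; lia.
Qed.

Ltac comp_hook ::=
  match goal with
  | |- comp _ (fun x => @?f x + @?g x) => apply (comp_add _ f g)
  | |- comp _ (fun x => @?f x * @?g x) => apply (comp_mul _ f g)
  | |- comp _ (fun x => pred (@?f x)) => apply (comp_pred _ f)
  | |- comp _ (fun x => @?f x - @?g x) => apply (comp_sub _ f g)
  | |- comp _ (fun x => 2 ^ @?f x) => apply (comp_pow2 _ f)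
  | |- comp _ (fun x => if @?b x then @?f x else @?g x) => apply (comp_if _ b f g)
  | |- comp _ (fun x => Nat.b2n (@?b x)) => change (compb _ b) || fail 1
  | |- compb _ (fun x => @?f x <=? @?g x) => apply (compb_leb _ f g)
  | |- compb _ (fun x => @?f x =? @?g x) => apply (compb_eqb _ f g)
  | |- compb _ (fun x => negb (@?b x)) => apply (compb_negb _ b)
  | |- compb _ (fun x => @?b x && @?c x) => apply (compb_andb _ b c)
  | |- compb _ (fun x => @?b x || @?c x) => apply (compb_orb _ b c)
  end.

(** * Bounded sums and quantifiers, search, and recursion on bits *)

Fixpoint nsum (n : nat) (f : nat -> nat) : nat :=
  match n with 0 => 0 | S n => nsum n f + f n end.

Lemma comp_nsum Q (f : nat -> nat -> nat) n :
  comp Q (fun w => f (p1 w) (p2 w)) -> comp Q n ->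
  comp Q (fun x => nsum (n x) (fun i => f i x)).
Proof.
intros Hf Hn.
eapply comp_ext;
  [|apply (comp_rec Q (fun i r x => r + f i x) n (fun _ => 0)); comp].
- intros x. simpl. induction (n x) as [|m IH]; simpl; auto.
Qed.

Definition bex (n : nat) (b : nat -> bool) : bool := existsb b (seq 0 n).

Lemma bex_spec n b : bex n b = true <-> exists i, i < n /\ b i = true.
Proof.
unfold bex. rewrite existsb_exists.
split; intros [i [H1 H2]]; exists i; rewrite in_seq in *; split; auto; lia.
Qed.

Lemma compb_bex Q (b : nat -> nat -> bool) n :
  compb Q (fun w => b (p1 w) (p2 w)) -> comp Q n ->
  compb Q (fun x => bex (n x) (fun i => b i x)).
Proof.
intros Hb Hn. unfold compb.
eapply comp_ext;
  [|apply (compb_negb Q (fun x => nsum (n x) (fun i => Nat.b2n (b i x)) =? 0));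
    apply compb_eqb; [apply (comp_nsum Q (fun i x => Nat.b2n (b i x))); assumption|comp]].
intros x. simpl. f_equal. unfold bex.
induction (n x) as [|m IH]; [reflexivity|].
rewrite seq_S, existsb_app, <- IH. simpl.
destruct (b m x); simpl;
  [rewrite Nat.add_1_r, orb_true_r; reflexivity|].
now rewrite Nat.add_0_r, orb_false_r.
Qed.

Lemma comp_min Q (b : nat -> nat -> bool) (f : nat -> nat) :
  compb Q (fun w => b (p1 w) (p2 w)) ->
  (forall x, b (f x) x = true /\ forall m, m < f x -> b m x = false) -> comp Q f.
Proof.
intros Hb Hf. apply compb_negb in Hb. destruct Hb as [e He].
exists (CMin e). intros O HO x. destruct (Hf x) as [H1 H2].
apply ev_min.
- intros m Hm. exists 0. specialize (He O HO (cp m x)).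
  now rewrite p1_cp, p2_cp, (H2 m Hm) in He.
- specialize (He O HO (cp (f x) x)). now rewrite p1_cp, p2_cp, H1 in He.
Qed.

(** [n / 2] counts the [m] with [2 m + 2 <= n]. *)
Lemma comp_half Q f : comp Q f -> comp Q (fun x => f x / 2).
Proof.
intros Hf.
eapply comp_ext;
  [|apply (comp_nsum Q (fun m x => if 2 * m + 2 <=? f x then 1 else 0) f); comp].
- intros x.
  assert (H : forall T n, nsum T (fun m => if 2 * m + 2 <=? n then 1 else 0) = Nat.min T (n / 2)).
  { intros T n. induction T as [|T IH]; [reflexivity|]. cbn [nsum]. rewrite IH.
    pose proof (Nat.div_mod_eq n 2). pose proof (Nat.mod_upper_bound n 2).
    destruct (Nat.leb_spec (2 * T + 2) n); lia. }
  cbv beta. rewrite H. apply Nat.min_r. apply Nat.Div0.div_le_upper_bound. lia.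
Qed.

Definition nfold (F : nat -> nat -> nat) (a n : nat) : nat :=
  fold_left (fun a b => F a (Nat.b2n b)) (str n) a.

(** The state pairs the accumulator with the number of the unread suffix. As a string is no longer
    than its number, [f x] rounds suffice, and rounds on the empty suffix change nothing. *)
Lemma comp_nfold Q F a f :
  comp Q (fun w => F (p1 w) (p2 w)) -> comp Q a -> comp Q f ->
  comp Q (fun x => nfold F (a x) (f x)).
Proof.
intros HF Ha Hf.
set (step := fun st => if p2 st =? 0 then st
  else cp (F (p1 st) (pred (p2 st) - 2 * (pred (p2 st) / 2))) (pred (p2 st) / 2)).
eapply comp_ext;
  [|apply (comp_p1 Q);
    apply (comp_rec Q (fun _ st _ => step st) f (fun x => cp (a x) (f x))); comp].
- intros x. simpl. unfold nfold.
  assert (H : forall s n a0, length s <= n ->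
    nat_rec (fun _ => nat) (cp a0 (nat_of_str s)) (fun _ st => step st) n =
    cp (fold_left (fun a b => F a (Nat.b2n b)) s a0) 0).
  { assert (Hs : forall n st, nat_rec (fun _ => nat) st (fun _ st => step st) (S n) =
      nat_rec (fun _ => nat) (step st) (fun _ st => step st) n).
    { induction n as [|n IH]; intros st; [reflexivity|]. simpl in *. now rewrite IH. }
    induction s as [|b s IH]; intros n a0 Hn.
    - clear Hn. simpl. induction n as [|n IHn]; [reflexivity|]. simpl. rewrite IHn.
      unfold step. now rewrite p2_cp.
    - destruct n as [|n]; simpl in Hn; [lia|]. rewrite Hs.
      assert (Hst : step (cp a0 (nat_of_str (b :: s))) = cp (F a0 (Nat.b2n b)) (nat_of_str s)).
      { unfold step. rewrite p2_cp, p1_cp. cbn [nat_of_str Nat.eqb pred].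
        set (m := nat_of_str s).
        assert (Hh : ((if b then 1 else 0) + 2 * m) / 2 = m).
        { rewrite Nat.mul_comm, Nat.div_add by lia. now destruct b. }
        now rewrite Hh, Nat.add_sub. }
      rewrite Hst. apply IH. lia. }
  pose proof (H (str (f x)) (f x) (a x) (length_str_le _)) as H'.
  rewrite nat_of_strK in H'. simpl in H'. now rewrite H', p1_cp.
- unfold step. comp; apply comp_half; comp.
Qed.

Definition len (n : nat) : nat := length (str n).

Lemma comp_len Q f : comp Q f -> comp Q (fun x => len (f x)).
Proof.
intros Hf. eapply comp_ext; [|apply (comp_nfold Q (fun a _ => S a) (fun _ => 0) f); comp].
intros x. simpl. unfold nfold, len.
assert (H : forall (s : list bool) a, fold_left (fun a _ => S a) s a = length s + a).
{ induction s as [|b s IH]; intros a; simpl; [reflexivity|]. rewrite IH. lia. }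
rewrite H. lia.
Qed.

(* Most significant bit first, so that extensions of [s] have values in
   [[val s * 2^k, (val s + 1) * 2^k)]. *)
Fixpoint val (s : list bool) : nat :=
  match s with [] => 0 | b :: s => Nat.b2n b * 2 ^ length s + val s end.

Lemma val_app (s s' : list bool) : val (s ++ s') = val s * 2 ^ length s' + val s'.
Proof.
induction s as [|b s IH]; simpl; [reflexivity|].
rewrite IH, length_app, Nat.pow_add_r. lia.
Qed.

Lemma val_lt (s : list bool) : val s < 2 ^ length s.
Proof. induction s as [|[] s IH]; simpl; lia. Qed.

Lemma val_surj (m v : nat) : v < 2 ^ m -> exists s, length s = m /\ val s = v.
Proof.
revert v. induction m as [|m IH]; intros v Hv; simpl in Hv.
- exists []. simpl. split; lia.
- destruct (le_lt_dec (2 ^ m) v) as [H|H].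
  + destruct (IH (v - 2 ^ m)) as [s [H1 H2]]; [lia|].
    exists (true :: s). simpl. rewrite H1, H2. split; lia.
  + destruct (IH v H) as [s [H1 H2]]. exists (false :: s). simpl. split; lia.
Qed.

Lemma comp_val Q f : comp Q f -> comp Q (fun x => val (str (f x))).
Proof.
intros Hf. eapply comp_ext; [|apply (comp_nfold Q (fun a b => 2 * a + b) (fun _ => 0) f); comp].
intros x. simpl. unfold nfold.
assert (H : forall s a, fold_left (fun a b => a + (a + 0) + Nat.b2n b) s a = a * 2 ^ length s + val s).
{ induction s as [|b s IH]; intros a; simpl; [lia|]. rewrite IH. destruct b; simpl; lia. }
now rewrite H.
Qed.

Definition npair (x y : nat) : nat := nat_of_str (pair_str (str x) (str y)).

Lemma comp_npair Q f g : comp Q f -> comp Q g -> comp Q (fun x => npair (f x) (g x)).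
Proof.
intros Hf Hg.
(* A doubled bit [b] before a string of number [m] gives the number [3 (b + 1) + 4 m], and the
   separator before it gives [5 + 4 m]. The state holds the number so far and the current power of
   4. *)
set (st := fun x => nfold (fun a b => cp (p1 a + 3 * S b * p2 a) (4 * p2 a)) (cp 0 1) (f x)).
assert (Hst : comp Q st).
{ apply comp_nfold; comp. }
eapply comp_ext;
  [|apply (comp_add Q (fun x => p1 (st x)) (fun x => p2 (st x) * (5 + 4 * g x))); comp].
intros x. unfold st, nfold, npair, pair_str.
  assert (H : forall s v w,
    fold_left (fun a b => cp (p1 a + 3 * S (Nat.b2n b) * p2 a) (4 * p2 a)) s (cp v w) =
    cp (v + w * nat_of_str (flat_map (fun b => [b; b]) s))
       (w * 2 ^ length (flat_map (fun b => [b; b]) s))).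
  { induction s as [|b s IH]; intros v w; cbn [fold_left flat_map app nat_of_str length Nat.pow].
    - f_equal; lia.
    - rewrite p1_cp, p2_cp, IH. f_equal; destruct b; simpl Nat.b2n; nia. }
  rewrite H, p1_cp, p2_cp, nat_of_str_app. cbn [app nat_of_str]. rewrite nat_of_strK. lia.
Qed.

(** Bounds the search for the second component in [hit]. *)
Lemma npair_ge (x y : nat) : y <= npair x y.
Proof.
unfold npair, pair_str. rewrite nat_of_str_app. cbn [app nat_of_str]. rewrite nat_of_strK.
pose proof (Nat.pow_nonzero 2 (length (flat_map (fun b => [b; b]) (str x)))). nia.
Qed.

Lemma pair_str_inj (x y x' y' : list bool) :
  pair_str x y = pair_str x' y' -> x = x' /\ y = y'.
Proof.
unfold pair_str. revert x'. induction x as [|b x IH]; intros [|b' x'] H; simpl in H.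
- injection H as ->. auto.
- injection H as H1 H2 _. congruence.
- injection H as H1 H2 _. congruence.
- injection H as H1 _ H2. destruct (IH x' H2) as [-> ->]. now subst b'.
Qed.

Lemma npair_inj (x y x' y' : nat) : npair x y = npair x' y' -> x = x' /\ y = y'.
Proof.
intros H. apply nat_of_str_inj, pair_str_inj in H. destruct H as [H1 H2].
apply (f_equal nat_of_str) in H1, H2. now rewrite !nat_of_strK in H1, H2.
Qed.

Ltac comp_hook2 ::=
  match goal with
  | |- comp _ (fun x => @?f x / 2) => apply (comp_half _ f)
  | |- comp _ (fun x => nsum (@?n x) (@?f x)) =>
      apply (comp_nsum _ (fun i x => f x i) n); cbv beta
  | |- compb _ (fun x => bex (@?n x) (@?b x)) =>
      apply (compb_bex _ (fun i x => b x i) n); cbv beta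
  | |- comp _ (fun x => len (@?f x)) => apply (comp_len _ f)
  | |- comp _ (fun x => val (str (@?f x))) => apply (comp_val _ f)
  | |- comp _ (fun x => npair (@?f x) (@?g x)) => apply (comp_npair _ f g)
  end.

(** * Time-bounded evaluation *)

Definition bind (m : nat) (f : nat -> nat) : nat :=
  match m with 0 => 0 | S y => f y end.

(* [0] encodes "no value within time [t]", [S y] the value [y].  In the case of [CMin]
   the search state is [0] while searching, [1] after a timeout, [S (S m)] on success at [m]. *)
Fixpoint tb (e : code) (t x : nat) : nat :=
  match e with
  | CZero => 1
  | CSucc => S (S x)
  | CId => S x
  | CFst => S (p1 x)
  | CSnd => S (p2 x)
  | CPair f g => bind (tb f t x) (fun a => bind (tb g t x) (fun b => S (cp a b)))
  | CComp f g => bind (tb g t x) (tb f t)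
  | CRec f g =>
      nat_rec _ (tb f t (p2 x)) (fun n r => bind r (fun r => tb g t (cp n (cp r (p2 x))))) (p1 x)
  | CMin f =>
      pred (nat_rec _ 0 (fun m st =>
        if st =? 0 then
          let v := tb f t (cp m x) in if v =? 0 then 1 else if v =? 1 then S (S m) else 0
        else st) t)
  | COracle => 1
  end.

Lemma comp_bind Q (f : nat -> nat -> nat) m :
  comp Q m -> comp Q (fun w => f (p1 w) (p2 w)) -> comp Q (fun x => bind (m x) (fun y => f y x)).
Proof.
intros Hm Hf.
eapply comp_ext; [|apply (comp_if Q (fun x => m x =? 0) (fun _ => 0) (fun x => f (pred (m x)) x)); comp].
intros x. simpl. now destruct (m x).
Qed.

(** The recursion on [e] happens outside the computed function: each fixed code gets an evaluator of
    its own, and no universal interpreter has to be built. *)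
Lemma comp_tb0 Q e : comp Q (fun w => tb e (p1 w) (p2 w)).
Proof.
induction e as [| | | | |f IHf g IHg|f IHf g IHg|f IHf g IHg|f IHf|]; cbn [tb]; comp.
- apply (comp_bind Q (fun a w => bind (tb g (p1 w) (p2 w)) (fun b => S (cp a b)))); [comp|].
  apply (comp_bind Q (fun b w => S (cp (p1 w) b))); comp.
- apply (comp_bind Q (fun y w => tb f (p1 w) y)); comp.
- apply (comp_rec Q (fun n r w => bind r (fun r => tb g (p1 w) (cp n (cp r (p2 (p2 w))))))); comp.
  apply (comp_bind Q (fun r w => tb g (p1 (p2 (p2 w))) (cp (p1 w) (cp r (p2 (p2 (p2 (p2 w)))))))); comp.
- apply (comp_rec Q (fun m st w =>
        if st =? 0 then
          let v := tb f (p1 w) (cp m (p2 w)) in if v =? 0 then 1 else if v =? 1 then S (S m) else 0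
        else st)); cbv zeta; comp.
Qed.

Lemma comp_tb Q e f g : comp Q f -> comp Q g -> comp Q (fun x => tb e (f x) (g x)).
Proof. apply (comp_comp2 Q (tb e)), comp_tb0. Qed.

Lemma tb_min (f : code) (t x n : nat) :
  tb (CMin f) t x = S n <->
  n < t /\ tb f t (cp n x) = 1 /\ forall m, m < n -> exists k, tb f t (cp m x) = S (S k).
Proof.
cbn [tb].
set (st := nat_rec _ _ _).
(* The invariant characterizes the states [0] and [S (S n)] in both directions; the state [1] is
   left over for timeouts. *)
assert (H : forall T,
  (st T = 0 -> forall m, m < T -> exists k, tb f t (cp m x) = S (S k)) /\
  (forall n, st T = S (S n) -> n < T /\ tb f t (cp n x) = 1 /\
     forall m, m < n -> exists k, tb f t (cp m x) = S (S k)) /\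
  ((forall m, m < T -> exists k, tb f t (cp m x) = S (S k)) -> st T = 0) /\
  (forall n, n < T -> tb f t (cp n x) = 1 ->
     (forall m, m < n -> exists k, tb f t (cp m x) = S (S k)) -> st T = S (S n))).
{ induction T as [|T (I1 & I2 & I3 & I4)].
  - repeat split; try lia; intros; simpl in *; try discriminate; lia.
  - assert (E : st (S T) = if st T =? 0 then if tb f t (cp T x) =? 0 then 1 else
       if tb f t (cp T x) =? 1 then S (S T) else 0 else st T) by reflexivity.
    rewrite E. clear E. split; [|split; [|split]].
    + destruct (Nat.eqb_spec (st T) 0) as [E|E]; [|lia]. specialize (I1 E).
      destruct (tb f t (cp T x)) as [|[|k]] eqn:Ek; simpl; try discriminate.
      intros _ m Hm. destruct (Nat.eq_dec m T) as [->|]; [eauto|apply I1; lia].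
    + intros n'. destruct (Nat.eqb_spec (st T) 0) as [E|E].
      * specialize (I1 E).
        destruct (tb f t (cp T x)) as [|[|k]] eqn:Ek; simpl; try discriminate.
        intros H. injection H as <-. auto.
      * intros H. destruct (I2 _ H) as (H1 & H2 & H3). auto.
    + intros H. rewrite I3 by auto. simpl.
      destruct (H T) as [k ->]; [lia|reflexivity].
    + intros n' H1 H2 H3. destruct (Nat.eq_dec n' T) as [->|Hn].
      * rewrite (I3 H3), H2. reflexivity.
      * rewrite (I4 n') by (auto; lia). reflexivity. }
destruct (H t) as (H1 & H2 & H3 & H4). split.
- intros E. apply H2. destruct (st t); simpl in E; [discriminate|congruence].
- intros (E1 & E2 & E3). now rewrite (H4 n E1 E2 E3).
Qed.

Lemma tb_mono (e : code) (t t' x y : nat) : t <= t' -> tb e t x = S y -> tb e t' x = S y.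
Proof.
intros Ht. revert x y.
induction e as [| | | | |f IHf g IHg|f IHf g IHg|f IHf g IHg|f IHf|]; intros x y H; auto.
- cbn [tb] in *. destruct (tb f t x) eqn:Ef; [discriminate|]. simpl in H.
  destruct (tb g t x) eqn:Eg; [discriminate|].
  now rewrite (IHf _ _ Ef), (IHg _ _ Eg).
- cbn [tb] in *. destruct (tb g t x) eqn:Eg; [discriminate|].
  rewrite (IHg _ _ Eg). now apply IHf.
- cbn [tb] in *. revert y H. induction (p1 x) as [|n IH]; intros y H; simpl in *; auto.
  destruct (nat_rec _ (tb f t (p2 x)) _ n) eqn:E; [discriminate|].
  rewrite (IH _ eq_refl). now apply IHg.
- apply tb_min in H. apply tb_min. destruct H as (H1 & H2 & H3).
  split; [lia|split; [auto|]]. intros m Hm. destruct (H3 m Hm) as [k Hk]. eauto.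
Qed.

Lemma tb_sound (e : code) (t x y : nat) : tb e t x = S y -> ev no_aux e x y.
Proof.
revert x y.
induction e as [| | | | |f IHf g IHg|f IHf g IHg|f IHf g IHg|f IHf|]; intros x y H.
- injection H as <-. constructor.
- injection H as <-. constructor.
- injection H as <-. constructor.
- injection H as <-. rewrite <- (cp_p1_p2 x) at 1. constructor.
- injection H as <-. rewrite <- (cp_p1_p2 x) at 1. constructor.
- cbn [tb] in H. destruct (tb f t x) eqn:Ef; [discriminate|]. simpl in H.
  destruct (tb g t x) eqn:Eg; [discriminate|]. injection H as <-. constructor; auto.
- cbn [tb] in H. destruct (tb g t x) eqn:Eg; [discriminate|]. econstructor; eauto.
- cbn [tb] in H. rewrite <- (cp_p1_p2 x) at 1. revert y H.
  induction (p1 x) as [|n IH]; intros y H; simpl in *; [constructor; auto|].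
  destruct (nat_rec _ (tb f t (p2 x)) _ n) eqn:E; [discriminate|].
  eapply ev_recS; [apply IH; reflexivity|]. auto.
- apply tb_min in H. destruct H as (H1 & H2 & H3).
  constructor; [|auto]. intros m Hm. destruct (H3 m Hm) as [k Hk]. eauto.
(* The value [1] of [tb] encodes the answer 0, which [no_aux] gives to every query. *)
- injection H as <-. apply (ev_oracle no_aux).
Qed.

(** * Inversion, determinism, and completeness of the time-bounded evaluation *)

Lemma ev_pair_inv O f g x y :
  ev O (CPair f g) x y -> exists a b, ev O f x a /\ ev O g x b /\ y = cp a b.
Proof. intros H. inversion H; subst. eauto. Qed.

Lemma ev_comp_inv O f g x z : ev O (CComp f g) x z -> exists y, ev O g x y /\ ev O f y z.
Proof. intros H. inversion H; subst. eauto. Qed.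

Lemma ev_rec0_inv O f g x y : ev O (CRec f g) (cp 0 x) y -> ev O f x y.
Proof.
intros H. inversion H as [| | | | | | |f' g' x' y' H1 Ef Ex|f' g' n x' r y' H1 H2 Ef Ex| |]; subst.
- apply cp_inj in Ex. destruct Ex as [_ ->]. auto.
- apply cp_inj in Ex. destruct Ex. discriminate.
Qed.

Lemma ev_recS_inv O f g n x y :
  ev O (CRec f g) (cp (S n) x) y ->
  exists r, ev O (CRec f g) (cp n x) r /\ ev O g (cp n (cp r x)) y.
Proof.
intros H. inversion H as [| | | | | | |f' g' x' y' H1 Ef Ex|f' g' n' x' r y' H1 H2 Ef Ex| |]; subst.
- apply cp_inj in Ex. destruct Ex. discriminate.
- apply cp_inj in Ex. destruct Ex as [En ->]. injection En as ->. eauto.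
Qed.

Lemma ev_min_inv O f x n :
  ev O (CMin f) x n ->
  ev O f (cp n x) 0 /\ forall m, m < n -> exists k, ev O f (cp m x) (S k).
Proof. intros H. inversion H; subst. auto. Qed.

Lemma ev_inj O e x y y' : ev O e x y -> ev O e x y' -> y = y'.
Proof.
revert x y y'.
induction e as [| | | | |f IHf g IHg|f IHf g IHg|f IHf g IHg|f IHf|]; intros x y y' H H'.
- inversion H; inversion H'; congruence.
- inversion H; inversion H'; congruence.
- inversion H; inversion H'; congruence.
- inversion H; inversion H'; subst.
  match goal with E : cp _ _ = cp _ _ |- _ => apply cp_inj in E; destruct E end. congruence.
- inversion H; inversion H'; subst.
  match goal with E : cp _ _ = cp _ _ |- _ => apply cp_inj in E; destruct E end. congruence.
- apply ev_pair_inv in H, H'.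
  destruct H as (a & b & H1 & H2 & ->), H' as (a' & b' & H1' & H2' & ->). f_equal; eauto.
- apply ev_comp_inv in H, H'. destruct H as (z & H1 & H2), H' as (z' & H1' & H2').
  rewrite (IHg _ _ _ H1 H1') in H2. eauto.
- rewrite <- (cp_p1_p2 x) in H, H'. revert y y' H H'.
  induction (p1 x) as [|n IH]; intros y y' H H'.
  + apply ev_rec0_inv in H, H'. eauto.
  + apply ev_recS_inv in H, H'. destruct H as (r & H1 & H2), H' as (r' & H1' & H2').
    rewrite (IH _ _ H1 H1') in H2. eauto.
- apply ev_min_inv in H, H'. destruct H as (H1 & H2), H' as (H1' & H2').
  destruct (lt_eq_lt_dec y y') as [[Hlt|]|Hlt]; [|assumption|].
  + destruct (H2' _ Hlt) as [k Hk]. specialize (IHf _ _ _ H1 Hk). discriminate.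
  + destruct (H2 _ Hlt) as [k Hk]. specialize (IHf _ _ _ H1' Hk). discriminate.
- inversion H; inversion H'; congruence.
Qed.

Lemma tb_complete (e : code) (x y : nat) : ev no_aux e x y -> exists t, tb e t x = S y.
Proof.
revert x y.
induction e as [| | | | |f IHf g IHg|f IHf g IHg|f IHf g IHg|f IHf|]; intros x y H.
- exists 0. now inversion H.
- exists 0. now inversion H.
- exists 0. now inversion H.
- exists 0. inversion H; subst. simpl. now rewrite p1_cp.
- exists 0. inversion H; subst. simpl. now rewrite p2_cp.
- apply ev_pair_inv in H. destruct H as (a & b & H1 & H2 & ->).
  destruct (IHf _ _ H1) as [t1 T1], (IHg _ _ H2) as [t2 T2].
  exists (t1 + t2). cbn [tb].
  now rewrite (tb_mono f t1 (t1 + t2) x a), (tb_mono g t2 (t1 + t2) x b) by (auto; lia).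
- apply ev_comp_inv in H. destruct H as (z & H1 & H2).
  destruct (IHg _ _ H1) as [t1 T1], (IHf _ _ H2) as [t2 T2].
  exists (t1 + t2). cbn [tb].
  rewrite (tb_mono g t1 (t1 + t2) x z) by (auto; lia). apply (tb_mono f t2); auto; lia.
- rewrite <- (cp_p1_p2 x) in *. revert y H.
  induction (p1 x) as [|n IH]; intros y H.
  + apply ev_rec0_inv in H. destruct (IHf _ _ H) as [t Ht]. exists t. cbn [tb].
    now rewrite p1_cp, p2_cp.
  + apply ev_recS_inv in H. destruct H as (r & H1 & H2).
    destruct (IH _ H1) as [t1 T1], (IHg _ _ H2) as [t2 T2].
    exists (t1 + t2). apply (tb_mono _ t1 (t1 + t2)) in T1; [|lia].
    apply (tb_mono _ t2 (t1 + t2)) in T2; [|lia].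
    cbn [tb] in *. rewrite p1_cp, p2_cp in *. simpl. now rewrite T1.
- apply ev_min_inv in H. destruct H as (H1 & H2).
  assert (H : exists t, forall m, m < y -> exists k, tb f t (cp m x) = S (S k)).
  { clear H1. induction y as [|y IH]; [exists 0; lia|].
    destruct IH as [t1 T1]; [auto|]. destruct (H2 y) as [k Hk]; [lia|].
    destruct (IHf _ _ Hk) as [t2 T2]. exists (t1 + t2). intros m Hm.
    destruct (Nat.eq_dec m y) as [->|].
    - exists k. apply (tb_mono f t2); auto; lia.
    - destruct (T1 m) as [k' Hk']; [lia|]. exists k'. apply (tb_mono f t1); auto; lia. }
  destruct H as [t1 T1], (IHf _ _ H1) as [t2 T2]. exists (S y + t1 + t2).
  apply tb_min. split; [lia|split].
  + apply (tb_mono f t2); auto; lia.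
  + intros m Hm. destruct (T1 m Hm) as [k Hk]. exists k. apply (tb_mono f t1); auto; lia.
- exists 0. inversion H; subst. reflexivity.
Qed.

(** * The Kraft-Chaitin construction *)

Fixpoint rsum (n : nat) (f : nat -> R) : R :=
  match n with 0 => 0%R | S n => (rsum n f + f n)%R end.

Lemma rsum_le n f g : (forall i, i < n -> (f i <= g i)%R) -> (rsum n f <= rsum n g)%R.
Proof.
intros H. induction n as [|n IH]; simpl; [lra|].
specialize (H n ltac:(lia)) as Hn. assert (rsum n f <= rsum n g)%R by (apply IH; auto). lra.
Qed.

Lemma rsum_ext n f g : (forall i, i < n -> f i = g i) -> rsum n f = rsum n g.
Proof. intros H. apply Rle_antisym; apply rsum_le; intros i Hi; rewrite H by easy; lra. Qed.

Lemma rsum_plus n f g : rsum n (fun i => f i + g i)%R = (rsum n f + rsum n g)%R.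
Proof. induction n as [|n IH]; simpl; [|rewrite IH]; ring. Qed.

Lemma rsum_scal n c f : rsum n (fun i => c * f i)%R = (c * rsum n f)%R.
Proof. induction n as [|n IH]; simpl; [|rewrite IH]; ring. Qed.

Lemma rsum_ge0 n f : (forall i, i < n -> (0 <= f i)%R) -> (0 <= rsum n f)%R.
Proof.
intros H. replace 0%R with (rsum n (fun _ => 0%R)); [now apply rsum_le|].
induction n as [|n IH]; simpl; [|rewrite IH by auto]; ring.
Qed.

Lemma rsum_mono m n f : (forall i, (0 <= f i)%R) -> m <= n -> (rsum m f <= rsum n f)%R.
Proof. intros Hf H. induction H as [|n H IH]; simpl; [lra|]. specialize (Hf n). lra. Qed.

Lemma rsum_exch m n f :
  rsum m (fun i => rsum n (f i)) = rsum n (fun j => rsum m (fun i => f i j)).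
Proof.
induction m as [|m IH]; simpl.
- induction n as [|n IHn]; simpl; [|rewrite <- IHn]; ring.
- now rewrite IH, <- rsum_plus.
Qed.

Lemma rsum_shift n f : rsum (S n) f = (f 0%nat + rsum n (fun i => f (S i)))%R.
Proof. induction n as [|n IH]; simpl in *; [|rewrite IH]; ring. Qed.

Lemma rsum_term n f i : (forall j, j < n -> (0 <= f j)%R) -> i < n -> (f i <= rsum n f)%R.
Proof.
induction n as [|n IH]; intros Hf Hi; [lia|]. simpl.
assert (0 <= rsum n f)%R by (apply rsum_ge0; auto). specialize (Hf n ltac:(lia)) as Hn.
destruct (Nat.eq_dec i n) as [->|]; [lra|].
assert (f i <= rsum n f)%R by (apply IH; auto; lia). lra.
Qed.

Definition ind (b : bool) (r : R) : R := if b then r else 0%R.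

Lemma ind_ge0 b r : (0 <= r)%R -> (0 <= ind b r)%R.
Proof. destruct b; simpl; lra. Qed.

Lemma rsum_ind_le n (b : nat -> bool) r :
  (0 <= r)%R -> (forall i j, i < n -> j < n -> b i = true -> b j = true -> i = j) ->
  (rsum n (fun i => ind (b i) r) <= r)%R.
Proof.
intros Hr. induction n as [|n IH]; intros H; simpl; [lra|].
destruct (b n) eqn:E; simpl; [|specialize (IH ltac:(auto)); lra].
rewrite (rsum_ext n _ (fun _ => 0 * 0)%R).
- rewrite rsum_scal. lra.
- intros i Hi. destruct (b i) eqn:Ei; simpl; [|ring].
  specialize (H i n ltac:(lia) ltac:(lia) Ei E). lia.
Qed.

(** * Dyadic weights and the Kraft inequality *)

Definition half (n : nat) : R := ((/ 2) ^ n)%R.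

Lemma half_S n : half (S n) = (/ 2 * half n)%R.
Proof. reflexivity. Qed.

Lemma half_add m n : half (m + n) = (half m * half n)%R.
Proof. apply pow_add. Qed.

Lemma half_pos n : (0 < half n)%R.
Proof. apply pow_lt. lra. Qed.

Lemma half_pow2 n : (half n * INR (2 ^ n) = 1)%R.
Proof.
induction n as [|n IH]; [unfold half; simpl; ring|].
rewrite half_S. change (2 ^ S n) with (2 ^ n + (2 ^ n + 0)). rewrite !plus_INR. simpl INR. lra.
Qed.

Lemma half_le m n : m <= n -> (half n <= half m)%R.
Proof.
intros H. induction H as [|n H IH]; [lra|]. rewrite half_S. pose proof (half_pos n). lra.
Qed.

Lemma is_prefix_comparable (p q p' q' : list bool) :
  is_prefix (p ++ q) (p' ++ q') -> is_prefix p p' \/ is_prefix p' p.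
Proof.
unfold is_prefix. revert p'. induction p as [|b p IH]; intros p' [r H].
- left. now exists p'.
- destruct p' as [|b' p']; [right; now exists (b :: p)|].
  simpl in H. injection H as -> H.
  destruct (IH p' (ex_intro _ r H)) as [[s ->]|[s ->]]; [left|right]; now exists s.
Qed.

(* Splitting strings by their first bit halves the weights. *)
Lemma kraft (N : nat) (P : nat -> bool) :
  (forall p q, P p = true -> P q = true -> is_prefix (str p) (str q) -> p = q) ->
  (rsum N (fun p => ind (P p) (half (len p))) <= 1)%R.
Proof.
revert P. induction N as [|N IH]; intros P HP; [simpl; lra|].
(* The range is enlarged so that it splits evenly: besides the empty string it contains [S (2 i)],
   starting with [false], and [S (S (2 i))], starting with [true], for [i < N]. *)
apply Rle_trans with (rsum (S (2 * N)) (fun p => ind (P p) (half (len p)))).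
{ apply rsum_mono; [|lia]. intros p. apply ind_ge0. pose proof (half_pos (len p)). lra. }
rewrite rsum_shift.
assert (Hsplit : forall f, rsum (2 * N) f = (rsum N (fun i => f (2 * i)%nat) + rsum N (fun i => f (S (2 * i))))%R).
{ intros f. clear. induction N as [|N IH]; [simpl; ring|].
  replace (2 * S N) with (S (S (2 * N))) by lia. cbn [rsum]. rewrite IH. ring. }
rewrite Hsplit.
assert (Hlen : forall b n, len (S (Nat.b2n b + 2 * n)) = S (len n)).
{ intros b n. unfold len. now rewrite str_cons. }
assert (Hb : forall b, (rsum N (fun i => ind (P (S (Nat.b2n b + 2 * i))) (half (len (S (Nat.b2n b + 2 * i))))) <= / 2)%R).
{ intros b. rewrite (rsum_ext N _ (fun i => / 2 * ind (P (S (Nat.b2n b + 2 * i))) (half (len i)))%R).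
  - rewrite rsum_scal. specialize (IH (fun i => P (S (Nat.b2n b + 2 * i)))).
    assert (rsum N (fun p => ind (P (S (Nat.b2n b + 2 * p))) (half (len p))) <= 1)%R; [|lra].
    apply IH. intros p q H1 H2 [r Hr].
    assert (E : S (Nat.b2n b + 2 * p) = S (Nat.b2n b + 2 * q)); [|lia].
    apply HP; auto. exists r. rewrite !str_cons, Hr. reflexivity.
  - intros i _. rewrite Hlen, half_S. destruct (P _); simpl; ring. }
pose proof (Hb false) as H0. pose proof (Hb true) as H1. simpl Nat.b2n in H0, H1.
destruct (P 0) eqn:E0.
- assert (Hz : forall p, P (S p) = false).
  { intros p. destruct (P (S p)) eqn:E; [|reflexivity].
    specialize (HP 0 (S p) E0 E (ex_intro _ (str (S p)) eq_refl)). discriminate. }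
  rewrite (rsum_ext N (fun i => ind (P (S (2 * i))) _) (fun _ => 0 * 0)%R) by (intros; now rewrite Hz; simpl; ring).
  rewrite (rsum_ext N (fun i => ind (P (S (S (2 * i)))) _) (fun _ => 0 * 0)%R) by (intros; now rewrite Hz; simpl; ring).
  rewrite !rsum_scal. simpl. unfold half, len. simpl. lra.
- simpl ind at 1. cbn [Nat.add] in *. lra.
Qed.

(* A request [r > 0] asks for a codeword of length [r]; it is served from an interval of
   twice the length of a dyadic interval of order [r], and [0] is no request. *)
Definition wt (r : nat) : R := if r =? 0 then 0%R else (2 * half r)%R.

Lemma wt_ge0 r : (0 <= wt r)%R.
Proof. unfold wt. pose proof (half_pos r). destruct (r =? 0); lra. Qed.

(* [cp num d] stands for the dyadic rational [num / 2^d]. *)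
Definition kc_add (r st : nat) : nat :=
  if r =? 0 then st else cp (p1 st * 2 ^ r + 2 * 2 ^ p2 st) (p2 st + r).

(** The dyadic interval of [q] lies in the stretch of length [wt r] that starts at the rational
    [st]; denominators are cleared. *)
Definition kc_test (st r q : nat) : bool :=
  negb (r =? 0) && (len q =? r) && (p1 st * 2 ^ r <=? val (str q) * 2 ^ p2 st) &&
  (S (val (str q)) * 2 ^ p2 st <=? p1 st * 2 ^ r + 2 * 2 ^ p2 st).

Definition kc_sum (rho : nat -> nat) (n : nat) : nat :=
  nat_rec _ 0 (fun j st => kc_add (rho j) st) n.

Lemma kc_sumE rho n :
  (INR (p1 (kc_sum rho n)) * half (p2 (kc_sum rho n)) = rsum n (fun j => wt (rho j)))%R.
Proof.
induction n as [|n IH]; [cbn; ring|].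
cbn [rsum]. rewrite <- IH. cbn [kc_sum nat_rec nat_rect]. fold (kc_sum rho n).
unfold kc_add, wt. destruct (Nat.eqb_spec (rho n) 0) as [_|Hn]; [ring|].
rewrite p1_cp, p2_cp, half_add, plus_INR, !mult_INR. simpl (INR 2).
pose proof (half_pow2 (rho n)) as H1. pose proof (half_pow2 (p2 (kc_sum rho n))) as H2.
set (a := half (rho n)) in *. set (b := half (p2 (kc_sum rho n))) in *.
transitivity (INR (p1 (kc_sum rho n)) * b * (a * INR (2 ^ rho n)) +
  2 * a * (b * INR (2 ^ p2 (kc_sum rho n))))%R; [ring|]. rewrite H1, H2. ring.
Qed.

Lemma kc_testE rho n r q :
  kc_test (kc_sum rho n) r q = true <->
  r <> 0 /\ len q = r /\
  (rsum n (fun j => wt (rho j)) <= INR (val (str q)) * half (len q))%R /\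
  ((INR (val (str q)) + 1) * half (len q) <= rsum n (fun j => wt (rho j)) + wt r)%R.
Proof.
rewrite <- kc_sumE. unfold kc_test, wt.
rewrite !andb_true_iff, negb_true_iff, Nat.eqb_neq, Nat.eqb_eq, !Nat.leb_le.
set (st := kc_sum rho n). set (v := val (str q)).
assert (Hle : forall x y m k : nat, (x * 2 ^ m <= y * 2 ^ k)%nat <-> (INR x * half k <= INR y * half m)%R).
{ intros x y m k.
  assert (E : (INR x * half k <= INR y * half m)%R <-> (INR (x * 2 ^ m) <= INR (y * 2 ^ k))%R).
  { rewrite !mult_INR. pose proof (half_pow2 m) as Hm. pose proof (half_pow2 k) as Hk.
    pose proof (half_pos m) as Pm. pose proof (half_pos k) as Pk.
    assert (E1 : (INR x * INR (2 ^ m) * (half m * half k) = INR x * half k)%R).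
    { transitivity (INR x * half k * (half m * INR (2 ^ m)))%R; [ring|]. rewrite Hm. ring. }
    assert (E2 : (INR y * INR (2 ^ k) * (half m * half k) = INR y * half m)%R).
    { transitivity (INR y * half m * (half k * INR (2 ^ k)))%R; [ring|]. rewrite Hk. ring. }
    rewrite <- E1, <- E2. pose proof (Rmult_lt_0_compat _ _ Pm Pk). split; intros H'.
    - eapply Rmult_le_reg_r; eauto.
    - apply Rmult_le_compat_r; lra. }
  rewrite E. split; [apply le_INR|apply INR_le]. }
split.
- intros [[[H1 H2] H3] H4]. subst r. split; [exact H1|]. split; [reflexivity|].
  apply Nat.eqb_neq in H1. rewrite H1. split; [now apply Hle|].
  apply le_INR in H4. rewrite plus_INR, !mult_INR, S_INR in H4. simpl (INR 2) in H4.
  pose proof (half_pow2 (len q)) as Hm. pose proof (half_pow2 (p2 st)) as Hk.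
  pose proof (half_pos (len q)) as Pm. pose proof (half_pos (p2 st)) as Pk.
  apply (Rmult_le_compat_r (half (len q) * half (p2 st))) in H4; [|nra].
  set (a := half (len q)) in *. set (b := half (p2 st)) in *.
  set (A := INR (2 ^ len q)) in *. set (B := INR (2 ^ p2 st)) in *.
  replace ((INR v + 1) * B * (a * b))%R with ((INR v + 1) * a * (b * B))%R in H4 by ring.
  replace ((INR (p1 st) * A + (1 + 1) * B) * (a * b))%R
    with (INR (p1 st) * b * (a * A) + 2 * a * (b * B))%R in H4 by ring.
  rewrite Hm, Hk in H4. lra.
- intros (H1 & H2 & H3 & H4). subst r. split; [split; [split; [exact H1|reflexivity]|]|].
  + now apply Hle.
  + apply Nat.eqb_neq in H1. rewrite H1 in H4.
    apply INR_le. rewrite plus_INR, !mult_INR, S_INR. simpl (INR 2).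
    pose proof (half_pow2 (len q)) as Hm. pose proof (half_pow2 (p2 st)) as Hk.
    pose proof (half_pos (len q)) as Pm. pose proof (half_pos (p2 st)) as Pk.
    pose proof (pos_INR (2 ^ len q)) as PA. pose proof (pos_INR (2 ^ p2 st)) as PB.
    set (a := half (len q)) in *. set (b := half (p2 st)) in *.
    set (A := INR (2 ^ len q)) in *. set (B := INR (2 ^ p2 st)) in *.
    apply (Rmult_le_compat_r (A * B)) in H4; [|nra].
    replace ((INR v + 1) * a * (A * B))%R with ((INR v + 1) * B * (a * A))%R in H4 by ring.
    replace ((INR (p1 st) * b + 2 * a) * (A * B))%R
      with (INR (p1 st) * A * (b * B) + 2 * B * (a * A))%R in H4 by ring.
    rewrite Hm, Hk in H4. lra.
Qed.

(** The dyadic interval of an extension lies inside that of its prefix, whereas the stretches of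
    different requests share at most an endpoint. Within one request all codewords have the same
    length, so a prefix there is an equality. *)
Lemma kc_overlap rho i i' q q' :
  kc_test (kc_sum rho i) (rho i) q = true -> kc_test (kc_sum rho i') (rho i') q' = true ->
  is_prefix (str q) (str q') -> i = i' /\ q = q'.
Proof.
intros H H' [s Hs]. apply kc_testE in H, H'.
destruct H as (H1 & H2 & H3 & H4), H' as (H1' & H2' & H3' & H4').
assert (Hlt : forall a b, a < b ->
  (rsum a (fun j => wt (rho j)) + wt (rho a) <= rsum b (fun j => wt (rho j)))%R).
{ intros a b Hab. apply (rsum_mono (S a) b (fun j => wt (rho j))); [|lia].
  intros. apply wt_ge0. }
pose proof (half_pos (len q)) as P. pose proof (half_pos (len q')) as P'.
assert (Hl : len q' = len q + length s) by (unfold len; rewrite Hs, length_app; lia).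
pose proof (half_pow2 (length s)) as E. pose proof (half_pos (length s)) as Ps.
rewrite Hs, val_app, plus_INR, mult_INR, Hl, half_add in H3', H4'.
pose proof (val_lt s) as Hv. pose proof (pos_INR (val s)) as Hv0.
apply le_INR in Hv. rewrite S_INR in Hv.
set (v := INR (val (str q))) in *. set (a := half (len q)) in *.
set (b := half (length s)) in *. set (A := INR (2 ^ length s)) in *. set (w := INR (val s)) in *.
assert (Hlo : (v * a <= (v * A + w) * (a * b))%R).
{ replace ((v * A + w) * (a * b))%R with (v * a * (b * A) + a * b * w)%R by ring.
  rewrite E. assert (0 <= a * b * w)%R by (repeat apply Rmult_le_pos; lra). lra. }
assert (Hhi : ((v * A + w + 1) * (a * b) <= (v + 1) * a)%R).
{ replace ((v + 1) * a)%R with (v * a * (b * A) + a * b * A)%R by (transitivity ((v + 1) * a * (b * A))%R; [ring|rewrite E; ring]).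
  assert (a * b * (w + 1) <= a * b * A)%R by (apply Rmult_le_compat_l; nra). lra. }
assert (Pab : (0 < a * b)%R) by nra.
destruct (lt_eq_lt_dec i i') as [[Hi|Hi]|Hi].
- specialize (Hlt _ _ Hi). lra.
- split; [exact Hi|]. rewrite Hi in H2. assert (length s = 0) by lia.
  destruct s; [|discriminate]. rewrite app_nil_r in Hs.
  rewrite <- (nat_of_strK q), <- (nat_of_strK q'). now rewrite Hs.
- specialize (Hlt _ _ Hi). lra.
Qed.

(** A stretch twice as long as a dyadic interval contains an aligned one, starting at the ceiling of
    its left end. Thus requests are served in order without managing free intervals, at the price of
    one bit. *)
Lemma kc_exists rho i :
  rho i <> 0 -> (rsum (S i) (fun j => wt (rho j)) <= 1)%R ->
  exists q, len q = rho i /\ kc_test (kc_sum rho i) (rho i) q = true.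
Proof.
intros Hi H. set (A := rsum i (fun j => wt (rho j))).
change (A + wt (rho i) <= 1)%R in H.
assert (HA : (0 <= A)%R) by (apply rsum_ge0; intros; apply wt_ge0).
pose proof (half_pow2 (rho i)) as E. pose proof (half_pos (rho i)) as P.
pose proof (pos_INR (2 ^ rho i)) as P2.
set (a := half (rho i)) in *. set (m := INR (2 ^ rho i)) in *.
(* The ceiling of [A * m]. Since [up] is strictly above its argument, it is one too large when
   [A * m] is an integer. *)
assert (Hv : exists v, (A * m <= INR v < A * m + 1)%R).
{ destruct (archimed (A * m)) as [U1 U2]. assert (0 <= A * m)%R by nra.
  assert (0 <= up (A * m))%Z by (apply le_IZR; lra).
  destruct (Req_dec (IZR (up (A * m))) (A * m + 1)) as [Eq|Neq].
  - assert (1 <= up (A * m))%Z by (apply le_IZR; lra).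
    exists (Z.to_nat (up (A * m) - 1)). rewrite INR_IZR_INZ, Z2Nat.id, minus_IZR by lia. lra.
  - exists (Z.to_nat (up (A * m))). rewrite INR_IZR_INZ, Z2Nat.id by lia. lra. }
destruct Hv as [v [V1 V2]].
assert (Hw : wt (rho i) = (2 * a)%R).
{ unfold wt. apply Nat.eqb_neq in Hi. now rewrite Hi. }
rewrite Hw in H.
assert (E' : (A * m * a = A)%R) by (transitivity (A * (a * m))%R; [ring|rewrite E; ring]).
destruct (val_surj (rho i) v) as [s [S1 S2]].
{ apply INR_lt. fold m. nra. }
exists (nat_of_str s). unfold len. rewrite strK. split; [exact S1|].
apply kc_testE. unfold len. rewrite strK, S1, S2, Hw. fold a A.
split; [exact Hi|split; [reflexivity|split]]; nra.
Qed.

(** * Codes for partial functions and the Kraft-Chaitin decoder *)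

Definition all_oracles : (nat -> bool) -> Prop := fun _ => True.

(** An equivalence, because prefix-freeness has to be read off from arbitrary runs of a partial
    code. *)
Lemma code_pre r f : comp all_oracles f ->
  exists e, forall O x y, ev O e x y <-> ev O r (f x) y.
Proof.
intros [d Hd]. exists (CComp r d). intros O x y. split.
- intros H. apply ev_comp_inv in H. destruct H as (z & H1 & H2).
  now rewrite (ev_inj _ _ _ _ _ H1 (Hd O I x)) in H2.
- intros H. econstructor; [now apply Hd|exact H].
Qed.

Lemma code_post r (g : nat -> nat -> nat) : comp all_oracles (fun w => g (p1 w) (p2 w)) ->
  exists e, forall O x z, ev O e x z <-> exists y, ev O r x y /\ z = g x y.
Proof.
intros [d Hd]. exists (CComp d (CPair CId r)). intros O x z.
assert (Hg : forall y, ev O d (cp x y) (g x y)).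
{ intros y. specialize (Hd O I (cp x y)). now rewrite p1_cp, p2_cp in Hd. }
split.
- intros H. apply ev_comp_inv in H. destruct H as (w & H1 & H2).
  apply ev_pair_inv in H1. destruct H1 as (a & y & H1 & H3 & ->).
  rewrite (ev_inj _ _ _ _ _ H1 (ev_id O x)) in H2.
  exists y. split; [exact H3|]. eapply ev_inj; [exact H2|apply Hg].
- intros (y & H & ->). econstructor; [constructor; [constructor|exact H]|apply Hg].
Qed.

Lemma code_min Q (b : nat -> nat -> bool) : compb Q (fun w => b (p1 w) (p2 w)) ->
  exists e, forall O, Q O -> forall x n,
    ev O e x n <-> b n x = true /\ forall m, m < n -> b m x = false.
Proof.
intros Hb. apply compb_negb in Hb. destruct Hb as [e He]. exists (CMin e).
intros O HO x n.
assert (H : forall m, ev O e (cp m x) (Nat.b2n (negb (b m x)))).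
{ intros m. specialize (He O HO (cp m x)). now rewrite p1_cp, p2_cp in He. }
split.
- intros E. apply ev_min_inv in E. destruct E as [E1 E2]. split.
  + specialize (ev_inj _ _ _ _ _ E1 (H n)). now destruct (b n x).
  + intros m Hm. destruct (E2 m Hm) as [k Hk].
    specialize (ev_inj _ _ _ _ _ Hk (H m)). now destruct (b m x).
- intros [E1 E2]. constructor.
  + intros m Hm. exists 0. specialize (H m). now rewrite (E2 m Hm) in H.
  + specialize (H n). now rewrite E1 in H.
Qed.

Lemma least_true (b : nat -> bool) n : b n = true ->
  exists m, m <= n /\ b m = true /\ forall k, k < m -> b k = false.
Proof.
induction n as [n IH] using (well_founded_induction lt_wf). intros Hn.
destruct (bex n b) eqn:E.
- apply bex_spec in E. destruct E as (i & Hi & Hb). destruct (IH i Hi Hb) as (m & Hm & H).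
  exists m. split; [lia|exact H].
- exists n. split; [lia|split; [exact Hn|]]. intros k Hk. destruct (b k) eqn:Ek; [|reflexivity].
  assert (bex n b = true) by (apply bex_spec; eauto). congruence.
Qed.

Lemma code_min_total Q (b : nat -> nat -> bool) : compb Q (fun w => b (p1 w) (p2 w)) ->
  (forall x, exists n, b n x = true) ->
  exists f, comp Q f /\ forall x, b (f x) x = true /\ forall m, m < f x -> b m x = false.
Proof.
intros Hb H.
set (f := fun x => epsilon (inhabits 0) (fun n => b n x = true /\ forall m, m < n -> b m x = false)).
assert (Hf : forall x, b (f x) x = true /\ forall m, m < f x -> b m x = false).
{ intros x. apply epsilon_spec. destruct (H x) as [n Hn].
  destruct (least_true (fun n => b n x) n Hn) as (m & _ & Hm). eauto. }
exists f. split; [|exact Hf]. exact (comp_min Q b f Hb Hf).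
Qed.

Lemma comp_kc_add Q f g : comp Q f -> comp Q g -> comp Q (fun x => kc_add (f x) (g x)).
Proof. intros Hf Hg. unfold kc_add. comp. Qed.

Lemma compb_kc_test Q f g h : comp Q f -> comp Q g -> comp Q h ->
  compb Q (fun x => kc_test (f x) (g x) (h x)).
Proof. intros Hf Hg Hh. unfold kc_test. comp. Qed.

(** The decoder maps [q] to the first request whose test accepts it. A test for [i] terminates only
    if the requests up to [i] are defined, so any two runs with the same oracle and parameter see
    the same requests where both see any. The parameter [a] will carry the condition z. *)
Lemma kc_code (r : code) : exists d,
  (forall O a q q' i i', ev O d (cp a q) i -> ev O d (cp a q') i' ->
     is_prefix (str q) (str q') -> q = q') /\
  (forall O a rho i, (forall j, j <= i -> ev O r (cp a j) (rho j)) -> rho i <> 0 ->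
     (rsum (S i) (fun j => wt (rho j)) <= 1)%R ->
     exists q, len q = rho i /\ ev O d (cp a q) i).
Proof.
destruct (code_pre r (fun w => cp (p2 (p2 w)) (p1 w))) as [r1 Hr1]; [comp|].
destruct (code_post r1 (fun w y => kc_add y (p1 (p2 w)))) as [step Hstep].
{ apply comp_kc_add; comp. }
assert (Hsum : forall O a n v, ev O (CRec CZero step) (cp n a) v <->
  exists rho, (forall j, j < n -> ev O r (cp a j) (rho j)) /\ v = kc_sum rho n).
{ intros O a n. induction n as [|n IH]; intros v.
  - split.
    + intros H. apply ev_rec0_inv in H. exists (fun _ => 0). split; [lia|].
      now inversion H.
    + intros (rho & _ & ->). constructor. constructor.
  - split.
    + intros H. apply ev_recS_inv in H. destruct H as (st & H1 & H2).
      apply IH in H1. destruct H1 as (rho & H1 & ->).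
      apply Hstep in H2. destruct H2 as (y & H2 & ->). apply Hr1 in H2.
      rewrite ?p2_cp, ?p1_cp in *.
      assert (Hext : forall rho' m, (forall j, j < m -> rho' j = rho j) -> kc_sum rho' m = kc_sum rho m).
      { intros rho' m. induction m as [|m IHm]; intros E; [reflexivity|].
        cbn. unfold kc_sum in IHm. rewrite IHm by auto. now rewrite E by lia. }
      exists (fun j => if j =? n then y else rho j). split.
      * intros j Hj. destruct (Nat.eqb_spec j n) as [->|]; [exact H2|apply H1; lia].
      * cbn. rewrite Nat.eqb_refl. f_equal. symmetry. apply Hext.
        intros j Hj. destruct (Nat.eqb_spec j n); [lia|reflexivity].
    + intros (rho & H & ->). eapply ev_recS.
      * apply IH. exists rho. split; [auto|reflexivity].
      * apply Hstep. exists (rho n). rewrite p2_cp, p1_cp. split; [|reflexivity].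
        apply Hr1. rewrite p2_cp, p1_cp, p2_cp. auto. }
destruct (code_pre (CRec CZero step) (fun w => cp (p1 w) (p1 (p2 w)))) as [c1 Hc1]; [comp|].
destruct (code_pre r (fun w => cp (p1 (p2 w)) (p1 w))) as [c2 Hc2]; [comp|].
destruct (code_post (CPair c1 c2)
  (fun w y => Nat.b2n (negb (kc_test (p1 y) (p2 y) (p2 (p2 w)))))) as [c Hc].
{ apply compb_negb. apply compb_kc_test; comp. }
assert (Htest : forall O a q i v, ev O c (cp i (cp a q)) v <->
  exists rho, (forall j, j <= i -> ev O r (cp a j) (rho j)) /\
    v = Nat.b2n (negb (kc_test (kc_sum rho i) (rho i) q))).
{ intros O a q i v. rewrite Hc. split.
  - intros (y & H & ->). apply ev_pair_inv in H. destruct H as (st & y' & H1 & H2 & ->).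
    apply Hc1 in H1. apply Hc2 in H2. rewrite ?p2_cp, ?p1_cp, ?p2_cp in *.
    apply Hsum in H1. destruct H1 as (rho & H1 & ->).
    assert (H3 : ev O (CRec CZero step) (cp (S i) a) (kc_add y' (kc_sum rho i))).
    { eapply ev_recS; [apply Hsum; eauto|]. apply Hstep. exists y'.
      rewrite p2_cp, p1_cp. split; [|reflexivity]. apply Hr1. now rewrite p2_cp, p1_cp, p2_cp. }
    exists (fun j => if j =? i then y' else rho j). rewrite Nat.eqb_refl. split.
    + intros j Hj. destruct (Nat.eqb_spec j i) as [->|]; [exact H2|apply H1; lia].
    + do 2 f_equal; f_equal. eapply ev_inj; [apply Hsum; exists rho; eauto|].
      apply Hsum. exists (fun j => if j =? i then y' else rho j). split; [|reflexivity].
      intros j Hj. destruct (Nat.eqb_spec j i); [lia|auto].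
  - intros (rho & H & ->). exists (cp (kc_sum rho i) (rho i)).
    rewrite !p2_cp, !p1_cp. split; [|reflexivity]. constructor.
    + apply Hc1. rewrite ?p2_cp, ?p1_cp. apply Hsum. exists rho. split; [intros; apply H; lia|reflexivity].
    + apply Hc2. rewrite ?p2_cp, ?p1_cp. auto. }
assert (Hagree : forall O a rho rho' n,
  (forall j, j < n -> ev O r (cp a j) (rho j)) -> (forall j, j < n -> ev O r (cp a j) (rho' j)) ->
  kc_sum rho n = kc_sum rho' n).
{ intros O a rho rho' n H H'. eapply ev_inj; apply (Hsum O a n); eauto. }
exists (CMin c). split.
- intros O a q q' i i' H H' Hp. apply ev_min_inv in H, H'.
  destruct H as [H _], H' as [H' _]. apply Htest in H, H'.
  destruct H as (rho & H1 & H2), H' as (rho' & H1' & H2').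
  destruct (kc_test (kc_sum rho i) (rho i) q) eqn:E; [|discriminate].
  destruct (kc_test (kc_sum rho' i') (rho' i') q') eqn:E'; [|discriminate].
  (* The two runs come with separate lists of requests; [ro] is one list that agrees with each of
     them up to the index where its run stops. *)
  set (ro := fun j => epsilon (inhabits 0) (fun y => ev O r (cp a j) y)).
  assert (Hro : forall y j, ev O r (cp a j) y -> ev O r (cp a j) (ro j)).
  { intros y j Hy. apply (epsilon_spec (inhabits 0) (fun y => ev O r (cp a j) y)). eauto. }
  apply (kc_overlap ro i i' q q'); [| |exact Hp].
  + rewrite <- E. f_equal.
    * apply (Hagree O a); intros j Hj; [eapply Hro|]; apply H1; lia.
    * eapply ev_inj; [eapply Hro|]; apply H1; lia.
  + rewrite <- E'. f_equal.
    * apply (Hagree O a); intros j Hj; [eapply Hro|]; apply H1'; lia.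
    * eapply ev_inj; [eapply Hro|]; apply H1'; lia.
- intros O a rho i H Hi Hs. destruct (kc_exists rho i Hi Hs) as (q & Hq & Ht).
  exists q. split; [exact Hq|]. constructor.
  + intros m Hm. exists 0. apply Htest. exists rho. split; [intros; apply H; lia|].
    destruct (kc_test (kc_sum rho m) (rho m) q) eqn:E; [|reflexivity].
    (* No earlier request accepts [q], since [q] is a prefix of itself; hence the minimization does
       not stop before [i]. *)
    destruct (kc_overlap rho i m q q Ht E) as [Him _]; [exists []; now rewrite app_nil_r|lia].
  + apply Htest. exists rho. split; [exact H|]. now rewrite Ht.
Qed.

(** * Complexity with respect to a universal machine *)

Lemma halts_iff e O p : halts e O p <-> exists y, ev O e (nat_of_str p) y.
Proof.
split; [intros [x H]; now exists (nat_of_str x)|].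
intros [y H]. exists (str y). unfold run. now rewrite nat_of_strK.
Qed.

Lemma prefix_freeP e : prefix_free e <->
  forall O p q x y, ev O e p x -> ev O e q y -> is_prefix (str p) (str q) -> p = q.
Proof.
split.
- intros H O p q x y Hp Hq Hpq.
  rewrite <- (nat_of_strK p), <- (nat_of_strK q). f_equal.
  apply (H O); [| |exact Hpq]; apply halts_iff; rewrite nat_of_strK; eauto.
- intros H O p q Hp Hq Hpq. apply halts_iff in Hp, Hq. destruct Hp as [x Hp], Hq as [y Hq].
  apply nat_of_str_inj. eapply H; eauto. now rewrite !strK.
Qed.

Lemma universalP u e : universal_pf u -> prefix_free e -> exists c, forall O p x,
  ev O e p x -> exists q, ev O u q x /\ len q <= len p + c.
Proof.
intros [_ Hu] He. destruct (Hu e He) as [c Hc]. exists c. intros O p x H.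
destruct (Hc O (str p) (str x)) as (q & H1 & H2).
{ unfold run. now rewrite !nat_of_strK. }
exists (nat_of_str q). unfold run in H1. rewrite nat_of_strK in H1.
split; [exact H1|]. unfold len. now rewrite strK.
Qed.

Lemma kc_universal u r psi : universal_pf u -> exists c, forall O rho i y,
  (forall j, j <= i -> ev O r j (rho j)) -> rho i <> 0 ->
  (rsum (S i) (fun j => wt (rho j)) <= 1)%R -> ev O psi i y ->
  exists q, ev O u q y /\ len q <= rho i + c.
Proof.
intros Hu. destruct (code_pre r p2) as [r' Hr']; [comp|].
destruct (kc_code r') as (d & Hpf & Hd).
destruct (code_pre d (fun q => cp 0 q)) as [d' Hd']; [comp|].
destruct (universalP u (CComp psi d') Hu) as [c Hc].
{ apply prefix_freeP. intros O p q x y Hp Hq Hpq.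
  apply ev_comp_inv in Hp, Hq. destruct Hp as (i & Hp & _), Hq as (j & Hq & _).
  apply Hd' in Hp, Hq. eapply Hpf; eauto. }
exists c. intros O rho i y H Hi Hs Hy.
destruct (Hd O 0 rho i) as (q & Hq & Hqi); [|exact Hi|exact Hs|].
{ intros j Hj. apply Hr'. rewrite p2_cp. auto. }
rewrite <- Hq. apply (Hc O). econstructor; [|exact Hy]. now apply Hd'.
Qed.

Lemma rsum_half n : (rsum n (fun i => half (S i)) <= 1 - half n)%R.
Proof.
induction n as [|n IH]; simpl; [unfold half; simpl; lra|]. rewrite half_S. lra.
Qed.

(** Requests of length [i + 2] weigh [2^-(i+1)], in total less than 1. This crude linear bound
    suffices to make complexities exist and to bound the search in [halting_decides]. *)
Lemma short_description u psi : universal_pf u -> exists c, forall O i y,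
  ev O psi i y -> exists q, ev O u q y /\ len q <= i + c.
Proof.
intros Hu. destruct (comp_S all_oracles (fun i => S i)) as [r Hr]; [comp|].
destruct (kc_universal u r psi Hu) as [c Hc].
exists (2 + c). intros O i y H.
destruct (Hc O (fun i => S (S i)) i y) as (q & Hq & Hl).
- intros j _. now apply Hr.
- discriminate.
- rewrite (rsum_ext _ _ (fun i => half (S i))).
  + pose proof (rsum_half (S i)). pose proof (half_pos (S i)). lra.
  + intros j _. unfold wt. simpl Nat.eqb. cbv iota. rewrite (half_S (S j)). lra.
- exact H.
- exists q. split; [exact Hq|lia].
Qed.

Definition Kn (u : code) (O : nat -> bool) (w : nat) : nat := Kc u O (str w).

(** [Kc] is chosen by [epsilon], so it means something only once some program for [w] is exhibited;
    the identity code yields one. *)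
Lemma Kn_spec u O w : universal_pf u ->
  (exists p, len p = Kn u O w /\ ev O u p w) /\ (forall p, ev O u p w -> Kn u O w <= len p).
Proof.
intros Hu.
assert (H : (exists p, length p = Kn u O w /\ run u O p (str w)) /\
            (forall p, run u O p (str w) -> Kn u O w <= length p)).
{ apply (epsilon_spec (inhabits 0) (fun n => (exists p, length p = n /\ run u O p (str w)) /\
    (forall p, run u O p (str w) -> n <= length p))).
  destruct (short_description u CId Hu) as [c Hc].
  destruct (Hc O w w (ev_id O w)) as (q & Hq & _).
  set (b := fun n => if excluded_middle_informative (exists p, length p = n /\ run u O p (str w))
                     then true else false).
  assert (Hb : forall n, b n = true <-> exists p, length p = n /\ run u O p (str w)).
  { intros n. unfold b. destruct (excluded_middle_informative _); split; auto; discriminate. }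
  destruct (least_true b (len q)) as (m & _ & Hm & Hmin).
  { apply Hb. exists (str q). split; [reflexivity|]. unfold run. now rewrite !nat_of_strK. }
  exists m. split; [now apply Hb|]. intros p Hp.
  destruct (le_lt_dec m (length p)) as [|Hlt]; [assumption|].
  specialize (Hmin _ Hlt). assert (b (length p) = true) by (apply Hb; eauto). congruence. }
destruct H as [(p & Hp & Hr) Hmin]. unfold run in *. rewrite nat_of_strK in *. split.
- exists (nat_of_str p). unfold len. now rewrite strK.
- intros q Hq. apply (Hmin (str q)). unfold run. now rewrite !nat_of_strK.
Qed.

(** * The coding theorem for marginals *)

Definition hit (u : code) (z t p : nat) : bool :=
  bex (tb u t p) (fun y => tb u t p =? S (npair z y)).

Lemma hitP u z t p : hit u z t p = true <-> exists y, tb u t p = S (npair z y).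
Proof.
unfold hit. rewrite bex_spec. split.
- intros (y & _ & H). apply Nat.eqb_eq in H. eauto.
- intros (y & H). exists y. rewrite H, Nat.eqb_refl. split; [|reflexivity].
  pose proof (npair_ge z y). lia.
Qed.

(** Approximation from below to the marginal at [z]; [t] cuts off both the programs and their
    running times. *)
Definition mass (u : code) (z t : nat) : R := rsum t (fun p => ind (hit u z t p) (half (len p))).

(** The inequality [2^-k <= mass u z t] multiplied by [2^(t+k)]. It is exact because
    [len p <= p < t] keeps the truncated subtraction from cutting. *)
Definition mass_ge (u : code) (z k t : nat) : bool :=
  2 ^ t <=? nsum t (fun p => if hit u z t p then 2 ^ (t - len p) else 0) * 2 ^ k.

Lemma mass_geP u z k t : mass_ge u z k t = true <-> (half k <= mass u z t)%R.
Proof.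
unfold mass_ge, mass. rewrite Nat.leb_le.
assert (H : forall m, m <= t ->
  INR (nsum m (fun p => if hit u z t p then 2 ^ (t - len p) else 0)) =
  (rsum m (fun p => ind (hit u z t p) (half (len p))) * INR (2 ^ t))%R).
{ induction m as [|m IH]; intros Hm; [simpl; ring|].
  cbn [nsum rsum]. rewrite plus_INR, IH, Rmult_plus_distr_r by lia. f_equal.
  destruct (hit u z t m); simpl; [|ring].
  pose proof (length_str_le m) as Hl. fold (len m) in Hl.
  replace (2 ^ t) with (2 ^ len m * 2 ^ (t - len m)) by (rewrite <- Nat.pow_add_r; f_equal; lia).
  rewrite mult_INR, <- Rmult_assoc, half_pow2. ring. }
specialize (H t (le_n t)). set (A := rsum _ _) in *. set (B := nsum _ _) in *.
pose proof (half_pow2 k) as Ek. pose proof (half_pos k) as Pk.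
assert (Pt : (0 < INR (2 ^ t))%R) by (apply lt_0_INR; pose proof (Nat.pow_nonzero 2 t); lia).
assert (Pk2 : (0 < INR (2 ^ k))%R) by (apply lt_0_INR; pose proof (Nat.pow_nonzero 2 k); lia).
split; intros HH.
- apply le_INR in HH. rewrite mult_INR, H in HH.
  apply (Rmult_le_reg_r (INR (2 ^ t) * INR (2 ^ k))); [nra|].
  replace (half k * (INR (2 ^ t) * INR (2 ^ k)))%R with (half k * INR (2 ^ k) * INR (2 ^ t))%R by ring.
  rewrite Ek. lra.
- apply INR_le. rewrite mult_INR, H.
  apply (Rmult_le_compat_r (INR (2 ^ t) * INR (2 ^ k))) in HH; [|nra].
  replace (half k * (INR (2 ^ t) * INR (2 ^ k)))%R with (half k * INR (2 ^ k) * INR (2 ^ t))%R in HH by ring.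
  rewrite Ek in HH. lra.
Qed.

Lemma mass_mono u z t t' : t <= t' -> (mass u z t <= mass u z t')%R.
Proof.
intros H. unfold mass.
apply Rle_trans with (rsum t (fun p => ind (hit u z t' p) (half (len p)))).
- apply rsum_le. intros p _. destruct (hit u z t p) eqn:E.
  + apply hitP in E. destruct E as [y E]. apply (tb_mono _ _ _ _ _ H) in E.
    assert (E' : hit u z t' p = true) by (apply hitP; eauto). rewrite E'. simpl. lra.
  + apply ind_ge0. pose proof (half_pos (len p)). lra.
- apply rsum_mono; [|exact H]. intros p. apply ind_ge0. pose proof (half_pos (len p)). lra.
Qed.

(** Both components of [i] are at most [i], so the square of side [N] covers all indices below
    [N]. *)
Lemma rsum_cp N (f : nat -> R) : (forall i, (0 <= f i)%R) ->
  (rsum N f <= rsum N (fun a => rsum N (fun b => f (cp a b))))%R.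
Proof.
intros Hf.
apply Rle_trans with
  (rsum N (fun i => rsum N (fun a => rsum N (fun b => ind (cp a b =? i) (f (cp a b)))))).
- apply rsum_le. intros i Hi.
  assert (H0 : forall a b, (0 <= ind (cp a b =? i) (f (cp a b)))%R) by (intros; now apply ind_ge0).
  eapply Rle_trans; [|apply (rsum_term N _ (p1 i))].
  + eapply Rle_trans; [|apply (rsum_term N _ (p2 i))].
    * cbv beta. rewrite cp_p1_p2, Nat.eqb_refl. simpl. lra.
    * auto.
    * pose proof (p2_le i). lia.
  + intros. apply rsum_ge0. auto.
  + pose proof (p1_le i). lia.
- rewrite rsum_exch. apply rsum_le. intros a _. rewrite rsum_exch. apply rsum_le. intros b _.
  apply (rsum_ind_le N (fun i => cp a b =? i)); [auto|].
  intros i j _ _ H1 H2. apply Nat.eqb_eq in H1, H2. lia.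
Qed.

(** From the first level [k] in [b] on, the geometric series sums to at most [2^-k]. The induction
    shifts the levels by one and doubles [s]. *)
Lemma rsum_levels N (b : nat -> bool) s : (0 <= s)%R ->
  (forall k, b k = true -> (half k <= s)%R) ->
  (rsum N (fun k => ind (b k) (half (S k))) <= s)%R.
Proof.
revert b s. induction N as [|N IH]; intros b s Hs H; [simpl; lra|].
destruct (b 0) eqn:E.
- apply H in E. unfold half in E. simpl in E.
  apply Rle_trans with 1%R; [|lra].
  apply Rle_trans with (rsum (S N) (fun k => half (S k))).
  + apply rsum_le. intros k _. pose proof (half_pos (S k)). destruct (b k); simpl; lra.
  + pose proof (rsum_half (S N)). pose proof (half_pos (S N)). lra.
- rewrite rsum_shift, E. simpl ind at 1.
  rewrite (rsum_ext N _ (fun k => / 2 * ind (b (S k)) (half (S k)))%R).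
  + rewrite rsum_scal. specialize (IH (fun k => b (S k)) (2 * s)%R ltac:(lra)).
    assert (rsum N (fun k => ind (b (S k)) (half (S k))) <= 2 * s)%R; [|lra].
    apply IH. intros k Hk. specialize (H _ Hk). rewrite half_S in H. lra.
  + intros k _. rewrite (half_S (S k)). destruct (b (S k)); simpl; ring.
Qed.

(** A program has one output, hence counts for at most one [z]; the rest is the Kraft inequality for
    the domain of [u]. *)
Lemma mass_total u N : prefix_free u -> (rsum N (fun z => mass u z N) <= 1)%R.
Proof.
intros Hu. unfold mass. rewrite rsum_exch.
apply Rle_trans with (rsum N (fun p => ind (negb (tb u N p =? 0)) (half (len p)))).
- apply rsum_le. intros p _. pose proof (half_pos (len p)) as P.
  destruct (tb u N p) eqn:E; simpl.
  + rewrite (rsum_ext N _ (fun _ => 0 * 0)%R); [rewrite rsum_scal; lra|].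
    intros z _. destruct (hit u z N p) eqn:Eh; [|simpl; ring].
    apply hitP in Eh. destruct Eh. congruence.
  + apply (rsum_ind_le N (fun z => hit u z N p)); [lra|].
    intros z z' _ _ H H'. apply hitP in H, H'. destruct H as [y H], H' as [y' H'].
    rewrite H in H'. injection H' as H'. now apply npair_inj in H'.
- apply kraft. intros p q Hp Hq.
  apply negb_true_iff, Nat.eqb_neq in Hp, Hq.
  destruct (tb u N p) eqn:Ep; [easy|]. destruct (tb u N q) eqn:Eq; [easy|].
  apply tb_sound in Ep, Eq. rewrite prefix_freeP in Hu. eapply Hu; eauto.
Qed.

Lemma mass_ge0 u z t : (0 <= mass u z t)%R.
Proof. apply rsum_ge0. intros. apply ind_ge0. pose proof (half_pos (len i)). lra. Qed.

Lemma mass_le1 u z t : prefix_free u -> (mass u z t <= 1)%R.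
Proof.
intros Hu. apply Rle_trans with (mass u z (t + S z)); [apply mass_mono; lia|].
eapply Rle_trans; [|apply (mass_total u (t + S z) Hu)].
apply (rsum_term _ (fun z0 => mass u z0 (t + S z))); [|lia]. intros. apply mass_ge0.
Qed.

(* Request [cp (cp z k) t]: a description of [z] of length [k + 2] when the mass of [z]
   reaches [2^-k] at time [t + 1]. *)
Definition crossing (u : code) (i : nat) : bool :=
  mass_ge u (p1 (p1 i)) (p2 (p1 i)) (S (p2 i)) && negb (mass_ge u (p1 (p1 i)) (p2 (p1 i)) (p2 i)).

(** The mass grows with time, so each pair of [z] and [k] has at most one crossing. The levels
    reached by [z] then cost at most its mass, and the masses add up to at most 1. *)
Lemma crossing_sum u N : prefix_free u ->
  (rsum N (fun i => ind (crossing u i) (half (S (p2 (p1 i))))) <= 1)%R.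
Proof.
intros Hu. set (F := fun i => ind (crossing u i) (half (S (p2 (p1 i))))).
assert (HF : forall i, (0 <= F i)%R).
{ intros i. apply ind_ge0. pose proof (half_pos (S (p2 (p1 i)))). lra. }
eapply Rle_trans; [apply (rsum_cp N F HF)|].
eapply Rle_trans; [apply (rsum_cp N (fun a => rsum N (fun t => F (cp a t))))|].
{ intros. apply rsum_ge0. auto. }
eapply Rle_trans; [|apply (mass_total u N Hu)].
apply rsum_le. intros z _.
apply Rle_trans with (rsum N (fun k => ind (mass_ge u z k N) (half (S k)))).
- apply rsum_le. intros k _. pose proof (half_pos (S k)) as P.
  unfold F, crossing.
  rewrite (rsum_ext N _ (fun t => ind (mass_ge u z k (S t) && negb (mass_ge u z k t)) (half (S k))));
    [|intros t _; now rewrite !p1_cp, !p2_cp].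
  assert (Hmon : forall t t', t <= t' -> mass_ge u z k t = true -> mass_ge u z k t' = true).
  { intros t t' Ht H. apply mass_geP in H. apply mass_geP.
    pose proof (mass_mono u z t t' Ht). lra. }
  destruct (mass_ge u z k N) eqn:EN; simpl.
  + apply (rsum_ind_le N (fun t => mass_ge u z k (S t) && negb (mass_ge u z k t))); [lra|].
    intros s t _ _ Hs Ht. apply andb_true_iff in Hs, Ht.
    destruct Hs as [Hs Hs'], Ht as [Ht Ht']. apply negb_true_iff in Hs', Ht'.
    destruct (lt_eq_lt_dec s t) as [[Hst|]|Hst]; [|assumption|].
    * rewrite (Hmon (S s) t) in Ht' by (auto; lia). discriminate.
    * rewrite (Hmon (S t) s) in Hs' by (auto; lia). discriminate.
  + rewrite (rsum_ext N _ (fun _ => 0 * 0)%R); [rewrite rsum_scal; lra|].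
    intros t Ht. destruct (mass_ge u z k (S t)) eqn:E; [|simpl; ring].
    rewrite (Hmon (S t) N) in EN by (auto; lia). discriminate.
- apply rsum_levels; [apply mass_ge0|]. intros k. now rewrite mass_geP.
Qed.

Lemma coding u : universal_pf u -> exists c, forall z k t,
  (half k <= mass u z t)%R -> Kn u no_aux z <= k + c.
Proof.
intros Hu.
assert (Hge : forall f g h, comp all_oracles f -> comp all_oracles g -> comp all_oracles h ->
  compb all_oracles (fun i => mass_ge u (f i) (g i) (h i))).
{ intros f g h Hf Hg Hh. unfold mass_ge, hit. comp; apply comp_tb; comp. }
destruct (comp_if all_oracles (crossing u) (fun i => p2 (p1 i) + 2) (fun _ => 0)) as [r Hr];
  [unfold crossing; comp; apply Hge; comp|comp|comp|].
destruct (comp_p1 all_oracles p1) as [psi Hpsi]; [comp|].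
destruct (kc_universal u r psi Hu) as [c Hc]. exists (2 + c).
intros z k t H. apply mass_geP in H.
destruct (least_true (mass_ge u z k) t H) as (m & _ & Hm & Hmin).
(* The mass at time 0 vanishes, so the threshold is first reached at a successor, as [crossing]
   requires. *)
destruct m as [|m].
{ apply mass_geP in Hm. unfold mass in Hm. simpl in Hm. pose proof (half_pos k). lra. }
set (i := cp (cp z k) m).
assert (Hi : crossing u i = true).
{ unfold crossing, i. rewrite !p1_cp, !p2_cp, Hm, (Hmin m) by lia. reflexivity. }
destruct (Hc no_aux (fun i => if crossing u i then p2 (p1 i) + 2 else 0) i z) as (q & Hq & Hl).
- intros j _. now apply Hr.
- rewrite Hi. lia.
- eapply Rle_trans; [|apply (crossing_sum u (S i)), Hu]. apply rsum_le. intros j _.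
  unfold wt. destruct (crossing u j); simpl; [|lra].
  rewrite Nat.add_comm. simpl Nat.eqb. cbv iota. cbn [Nat.add]. rewrite (half_S (S _)). lra.
- specialize (Hpsi no_aux I i). unfold i in *. now rewrite !p1_cp in Hpsi.
- rewrite Hi in Hl. unfold i in Hl. rewrite p1_cp, p2_cp in Hl.
  destruct (Kn_spec u no_aux z Hu) as [_ Hmin']. specialize (Hmin' _ Hq). lia.
Qed.

(** Shortest programs of different pairs are different, and by some time [t] those for [y < n] have
    all halted; so their weights are part of the mass of [z], which [coding] bounds. *)
Lemma coding_sum u : universal_pf u -> exists c, forall z n,
  (rsum n (fun y => half (Kn u no_aux (npair z y) + c)) <= half (Kn u no_aux z))%R.
Proof.
intros Hu. destruct (coding u Hu) as [c Hc]. exists (S c). intros z n.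
set (k := fun y => Kn u no_aux (npair z y)).
assert (H1 : exists t, (rsum n (fun y => half (k y)) <= mass u z t)%R).
{ assert (Hprog : exists t, forall y, y < n ->
    exists p, p < t /\ len p = k y /\ tb u t p = S (npair z y)).
  { induction n as [|n [t1 H1]]; [exists 0; lia|].
    destruct (Kn_spec u no_aux (npair z n) Hu) as [(p & Hp & Hev) _].
    destruct (tb_complete u p _ Hev) as [t2 H2].
    exists (S p + t1 + t2). intros y Hy. destruct (Nat.eq_dec y n) as [->|].
    - exists p. split; [lia|split; [exact Hp|]]. apply (tb_mono u t2); [lia|exact H2].
    - destruct (H1 y) as (q & Hq & Hl & Ht); [lia|]. exists q.
      split; [lia|split; [exact Hl|]]. apply (tb_mono u t1); [lia|exact Ht]. }
  destruct Hprog as [t Ht]. exists t.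
  apply Rle_trans with (rsum n (fun y => rsum t (fun p =>
    ind (tb u t p =? S (npair z y)) (half (len p))))).
  - apply rsum_le. intros y Hy. destruct (Ht y Hy) as (p & Hp & Hl & He).
    eapply Rle_trans; [|apply (rsum_term t _ p)].
    + cbv beta. rewrite He, Nat.eqb_refl, Hl. simpl. lra.
    + intros j _. apply ind_ge0. pose proof (half_pos (len j)). lra.
    + exact Hp.
  - rewrite rsum_exch. unfold mass. apply rsum_le. intros p _.
    pose proof (half_pos (len p)) as P. destruct (hit u z t p) eqn:E; simpl.
    + apply (rsum_ind_le n (fun y => tb u t p =? S (npair z y))); [lia || lra|].
      intros y y' _ _ Hy Hy'. apply Nat.eqb_eq in Hy, Hy'. rewrite Hy in Hy'.
      injection Hy' as Hy'. now apply npair_inj in Hy'.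
    + rewrite (rsum_ext n _ (fun _ => 0 * 0)%R); [rewrite rsum_scal; lra|].
      intros y _. destruct (Nat.eqb_spec (tb u t p) (S (npair z y))) as [E'|]; [|simpl; ring].
      assert (hit u z t p = true) by (apply hitP; eauto). congruence. }
destruct H1 as [t H1].
rewrite (rsum_ext n _ (fun y => half (S c) * half (k y))%R)
  by (intros; rewrite half_add; unfold k; ring).
rewrite rsum_scal.
pose proof (half_pos (S c)) as Pc.
apply Rle_trans with (half (S c) * mass u z t)%R; [apply Rmult_le_compat_l; lra|].
(* For small [K(z)] the level [K(z) - S c] would be truncated, but there mass at most 1 is enough.
   Otherwise, reaching that level would give [K(z) <= K(z) - 1]. *)
destruct (le_lt_dec (Kn u no_aux z) c) as [Hle|Hlt].
- apply Rle_trans with (half (S c)); [|apply half_le; lia].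
  pose proof (mass_le1 u z t (proj1 Hu)). nra.
- destruct (Rle_lt_dec (half (Kn u no_aux z - S c)) (mass u z t)) as [H|H].
  + specialize (Hc _ _ _ H). lia.
  + replace (Kn u no_aux z) with (S c + (Kn u no_aux z - S c)) at 1 by lia.
    rewrite half_add. nra.
Qed.

(** * Computing with the halting sequence *)

Definition halting (u : code) : (nat -> bool) -> Prop := fun O => O = halting_seq u.

Lemma halting_seqP u p : halting_seq u p = true <-> exists y, ev no_aux u p y.
Proof.
unfold halting_seq. destruct (excluded_middle_informative _); split; auto; discriminate.
Qed.

Lemma compb_halting u f : comp (halting u) f -> compb (halting u) (fun x => halting_seq u (f x)).
Proof.
intros Hf. apply (comp_comp _ (fun n => Nat.b2n (halting_seq u n)) f); [|exact Hf].
exists COracle. intros O -> x. apply ev_oracle.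
Qed.

(** Run under another oracle, [g] itself might return other values; simulation by [tb] fixes all its
    queries to the answers of [no_aux]. *)
Lemma total_value g Q : (forall x, exists y, ev no_aux g x y) ->
  exists f, comp Q f /\ forall x, ev no_aux g x (f x).
Proof.
intros Hg.
destruct (code_min_total Q (fun t x => negb (tb g t x =? 0))) as (T & HT & HTs).
- comp. apply comp_tb0.
- intros x. destruct (Hg x) as [y Hy]. destruct (tb_complete g x y Hy) as [t Ht].
  exists t. now rewrite Ht.
- exists (fun x => pred (tb g (T x) x)). split; [comp; apply comp_tb; comp|].
  intros x. destruct (HTs x) as [H _]. apply negb_true_iff, Nat.eqb_neq in H.
  destruct (tb g (T x) x) eqn:E; [easy|]. now apply tb_sound in E.
Qed.

(** The oracle tells beforehand whether waiting for [p] will end; outside the domain [f] takes a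
    default value. *)
Lemma halting_value u : exists f, comp (halting u) f /\
  forall p y, ev no_aux u p y -> f p = y.
Proof.
destruct (code_min_total (halting u) (fun t p => negb (halting_seq u p) || negb (tb u t p =? 0)))
  as (T & HT & HTs).
- comp; [apply compb_halting; comp|apply comp_tb0].
- intros p. destruct (halting_seq u p) eqn:E; [|now exists 0].
  apply halting_seqP in E. destruct E as [y Hy]. destruct (tb_complete u p y Hy) as [t Ht].
  exists t. now rewrite Ht.
- exists (fun p => pred (tb u (T p) p)). split; [comp; apply comp_tb; comp|].
  intros p y Hy. destruct (HTs p) as [H _].
  assert (E : halting_seq u p = true) by (apply halting_seqP; eauto). rewrite E in H.
  apply negb_true_iff, Nat.eqb_neq in H.
  destruct (tb u (T p) p) eqn:Et; [easy|]. apply tb_sound in Et. simpl. eapply ev_inj; eauto.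
Qed.

(* A witness found by a search has a description about as long as its instance, so the
   halting programs up to a computable length bound produce one whenever there is any. *)
Lemma halting_decides u (b : nat -> nat -> bool) : universal_pf u ->
  (forall Q, compb Q (fun w => b (p1 w) (p2 w))) ->
  exists d, compb (halting u) d /\ forall x, d x = true <-> exists s, b s x = true.
Proof.
intros Hu Hb.
destruct (code_min all_oracles b (Hb _)) as [psi Hpsi].
destruct (short_description u psi Hu) as [c Hc].
destruct (halting_value u) as (U & HU & HUs).
specialize (Hb (halting u)).
(* Strings of length at most [x + c] have numbers below [2^(x+c+1)]. *)
exists (fun x => bex (2 ^ S (x + c)) (fun q => halting_seq u q && b (U q) x)). split.
- comp. apply compb_halting. comp.
- intros x. rewrite bex_spec. split.
  + intros (q & _ & H). apply andb_true_iff in H. destruct H as [_ H]. eauto.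
  + intros [s Hs]. destruct (least_true (fun s => b s x) s Hs) as (m & _ & Hm & Hmin).
    destruct (Hc no_aux x m) as (q & Hq & Hl); [apply Hpsi; [exact I|auto]|].
    exists q. split.
    * pose proof (length_str_bounds (str q)) as H. rewrite nat_of_strK in H.
      assert (2 ^ length (str q) <= 2 ^ (x + c)) by (apply Nat.pow_le_mono_r; [lia|exact Hl]).
      simpl. lia.
    * rewrite (HUs _ _ Hq), Hm, andb_true_r. apply halting_seqP. eauto.
Qed.

(** The numerically first program for [w] is a shortest one, since the numbering is by length. *)
Lemma comp_Kn u : universal_pf u -> comp (halting u) (Kn u no_aux).
Proof.
intros Hu. destruct (halting_value u) as (U & HU & HUs).
destruct (code_min_total (halting u) (fun p w => halting_seq u p && (U p =? w)))
  as (P & HP & HPs).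
- comp. apply compb_halting. comp.
- intros w. destruct (Kn_spec u no_aux w Hu) as [(p & _ & Hp) _]. exists p.
  rewrite (HUs _ _ Hp), Nat.eqb_refl, andb_true_r. apply halting_seqP. eauto.
- eapply comp_ext; [|apply comp_len, HP]. intros w. simpl.
  destruct (HPs w) as [H Hmin]. apply andb_true_iff in H. destruct H as [H1 H2].
  apply halting_seqP in H1. destruct H1 as [y Hy]. apply Nat.eqb_eq in H2.
  rewrite (HUs _ _ Hy) in H2. subst y.
  destruct (Kn_spec u no_aux w Hu) as [(p & Hl & Hp) Hle]. specialize (Hle _ Hy).
  enough (len (P w) <= len p) by lia. apply length_str_mono.
  destruct (le_lt_dec (P w) p) as [|Hlt]; [assumption|].
  specialize (Hmin _ Hlt). rewrite (HUs _ _ Hp), Nat.eqb_refl, andb_true_r in Hmin.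
  assert (halting_seq u p = true) by (apply halting_seqP; eauto). congruence.
Qed.

(** Whether the output still changes at or after time [t] is an existential question, which H
    decides; the value at the first [t] without later changes is the limit. *)
Lemma limit_code u g : universal_pf u -> (forall x t, exists y, ev no_aux g (cp x t) y) ->
  exists e, forall x z,
    (exists t0, forall t, t0 <= t -> ev no_aux g (cp x t) z) -> ev (halting_seq u) e x z.
Proof.
intros Hu Hg.
assert (Hg' : forall w, exists y, ev no_aux g w y).
{ intros w. rewrite <- (cp_p1_p2 w). apply Hg. }
destruct (total_value g all_oracles Hg') as (G & _ & HG).
assert (HGc : forall Q, comp Q G).
{ intros Q. destruct (total_value g Q Hg') as (G' & HG' & HGs).
  eapply comp_ext; [|exact HG']. intros x. eapply ev_inj; eauto. }
set (b := fun s w => (p2 w <=? s) && negb (G (cp (p1 w) s) =? G (cp (p1 w) (S s)))).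
destruct (halting_decides u b Hu) as (d & Hd & Hds).
{ intros Q. specialize (HGc Q). unfold b. comp. }
destruct (code_min (halting u) (fun t x => negb (d (cp x t)))) as [e He].
{ apply compb_negb. apply (comp_comp _ (fun w => Nat.b2n (d w))); [exact Hd|comp]. }
destruct (HGc all_oracles) as [eG HeG].
exists (CComp eG (CPair CId e)). intros x z [t0 Ht0].
assert (Hz : forall t, t0 <= t -> G (cp x t) = z).
{ intros t Ht. eapply ev_inj; [apply HG|now apply Ht0]. }
assert (Hstable : forall t, negb (d (cp x t)) = true <-> forall s, t <= s -> G (cp x s) = G (cp x (S s))).
{ intros t. split.
  - intros H s Hs. destruct (Nat.eqb_spec (G (cp x s)) (G (cp x (S s)))) as [E|E]; [exact E|].
    assert (Hb : d (cp x t) = true).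
    { apply Hds. exists s. unfold b. rewrite p1_cp, p2_cp.
      apply Nat.leb_le in Hs. apply Nat.eqb_neq in E. now rewrite Hs, E. }
    rewrite Hb in H. discriminate.
  - intros H. destruct (d (cp x t)) eqn:E; [|reflexivity].
    apply Hds in E. destruct E as [s E]. unfold b in E. rewrite p1_cp, p2_cp in E.
    apply andb_true_iff in E. destruct E as [E1 E2]. apply Nat.leb_le in E1.
    rewrite (H s E1), Nat.eqb_refl in E2. discriminate. }
destruct (least_true (fun t => negb (d (cp x t))) t0) as (m & Hm & Hmd & Hmin).
{ apply Hstable. intros s Hs. rewrite !Hz by lia. reflexivity. }
assert (Hval : forall k, G (cp x (m + k)) = G (cp x m)).
{ rewrite Hstable in Hmd. induction k as [|k IH]; [now rewrite Nat.add_0_r|].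
  rewrite Nat.add_succ_r, <- Hmd by lia. exact IH. }
rewrite <- (Hz (m + t0)) by lia. rewrite Hval.
econstructor; [|apply HeG; exact I]. constructor; [constructor|].
apply He; [reflexivity|]. auto.
Qed.

(** * Two-part descriptions *)

(** By prefix-freeness a string has at most one decomposition, so whichever the search meets first
    is the right one. *)
Lemma split_code u : prefix_free u -> exists e,
  (forall O s w, ev O e s w -> s = nat_of_str (str (p1 w) ++ str (p1 (p2 w))) /\
     ev no_aux u (p1 w) (p2 (p2 w))) /\
  (forall O p q x, ev no_aux u p x -> ev O e (nat_of_str (str p ++ str q)) (cp p (cp q x))).
Proof.
intros Hu.
(* [n] holds both parts of the string and a running time; the left side is the number of their
   concatenation. *)
set (b := fun n s => (p1 (p1 n) + 2 ^ len (p1 (p1 n)) * p2 (p1 n) =? s) &&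
                     negb (tb u (p2 n) (p1 (p1 n)) =? 0)).
destruct (code_min all_oracles b) as [e He].
{ unfold b. comp. apply comp_tb; comp. }
destruct (code_post e (fun _ n => cp (p1 (p1 n)) (cp (p2 (p1 n)) (pred (tb u (p2 n) (p1 (p1 n)))))))
  as [f Hf].
{ comp. apply comp_tb; comp. }
assert (Happ : forall p q, nat_of_str (str p ++ str q) = p + 2 ^ len p * q).
{ intros p q. now rewrite nat_of_str_app, !nat_of_strK. }
assert (Hsound : forall O s w, ev O f s w -> s = nat_of_str (str (p1 w) ++ str (p1 (p2 w))) /\
     ev no_aux u (p1 w) (p2 (p2 w))).
{ intros O s w H. apply Hf in H. destruct H as (n & H & ->).
  apply (He O I) in H. destruct H as [H _]. unfold b in H.
  apply andb_true_iff in H. destruct H as [H1 H2].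
  apply Nat.eqb_eq in H1. apply negb_true_iff, Nat.eqb_neq in H2.
  rewrite !p1_cp, !p2_cp, p1_cp, Happ. split; [auto|].
  destruct (tb u (p2 n) (p1 (p1 n))) eqn:E; [easy|]. now apply tb_sound in E. }
exists f. split; [exact Hsound|].
intros O p q x Hx. destruct (tb_complete u p x Hx) as [t Ht].
set (s := nat_of_str (str p ++ str q)).
destruct (least_true (fun n => b n s) (cp (cp p q) t)) as (m & _ & Hm & Hmin).
{ unfold b, s. rewrite !p1_cp, !p2_cp, Ht, Happ, Nat.eqb_refl. reflexivity. }
assert (Hev : exists w, ev O f s w).
{ eexists. apply Hf. exists m. split; [|reflexivity]. apply (He O I). auto. }
destruct Hev as [w Hw]. destruct (Hsound O s w Hw) as [H1 H2].
unfold s in H1. apply nat_of_str_inj in H1.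
assert (Ep : p1 w = p).
{ rewrite prefix_freeP in Hu.
  destruct (is_prefix_comparable (str p) (str q) (str (p1 w)) (str (p1 (p2 w)))) as [H|H].
  - exists []. now rewrite app_nil_r.
  - symmetry. eapply Hu; eauto.
  - eapply Hu; eauto. }
rewrite Ep in *. apply app_inv_head in H1.
rewrite <- (cp_p1_p2 w), <- (cp_p1_p2 (p2 w)), Ep in Hw.
rewrite <- (ev_inj _ _ _ _ _ H2 Hx).
apply (f_equal nat_of_str) in H1. rewrite !nat_of_strK in H1. rewrite <- H1 in Hw. exact Hw.
Qed.

Lemma Kn_limit u g : universal_pf u -> (forall x t, exists y, ev no_aux g (cp x t) y) ->
  exists c, forall x y z, (exists t0, forall t, t0 <= t -> ev no_aux g (cp x t) z) ->
    Kn u (halting_seq u) (npair x y) + Kn u no_aux z <=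
    Kn u no_aux x + Kn u no_aux (npair z y) + c.
Proof.
intros Hu Hg.
destruct (coding_sum u Hu) as [c1 Hc1].
destruct (split_code u (proj1 Hu)) as (sp & Hsp1 & Hsp2).
destruct (limit_code u g Hu Hg) as [L HL].
(* [c1] brings the total weight down to 1; the final 1 offsets the factor 2 in [wt] and makes every
   request positive. *)
set (req := fun w => Kn u no_aux (npair (p1 w) (p2 w)) + c1 - Kn u no_aux (p1 w) + 1).
assert (Hreq : comp (halting u) req).
{ pose proof (comp_Kn u Hu) as HK. unfold req. comp. }
destruct Hreq as [r Hr].
destruct (kc_code r) as (d & Hd1 & Hd2).
destruct (code_pre L (fun v => p2 (p2 v))) as [L' HL']; [comp|].
destruct (code_pre CId (fun v => p1 (p2 v))) as [Q HQ]; [comp|].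
destruct (code_post (CComp d (CPair L' Q)) (fun v y => npair (p2 (p2 v)) y)) as [out Hout].
{ apply comp_npair; comp. }
destruct (universalP u (CComp out sp) Hu) as [c2 Hc2].
(* For any oracle: comparable inputs have the same first part, hence the same x, hence by
   determinism the same result of [L], be it the limit or not; then their second parts are codewords
   of one code. *)
{ apply prefix_freeP. intros O s s' r1 r2 Hs Hs' [tl Htl].
  apply ev_comp_inv in Hs, Hs'. destruct Hs as (v & Hv & Hs), Hs' as (v' & Hv' & Hs').
  apply Hsp1 in Hv, Hv'. destruct Hv as [-> Hv], Hv' as [-> Hv'].
  rewrite !strK in Htl.
  assert (Ep : p1 v = p1 v').
  { pose proof (proj1 (prefix_freeP u) (proj1 Hu)) as Hpf.
    destruct (is_prefix_comparable (str (p1 v)) (str (p1 (p2 v))) (str (p1 v')) (str (p1 (p2 v')))) as [H|H].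
    - now exists tl.
    - eapply Hpf; eauto.
    - symmetry. eapply Hpf; eauto. }
  rewrite <- Ep in *. pose proof (ev_inj _ _ _ _ _ Hv Hv') as Ex.
  rewrite <- app_assoc in Htl. apply app_inv_head in Htl.
  apply Hout in Hs, Hs'. destruct Hs as (y & Hs & _), Hs' as (y' & Hs' & _).
  apply ev_comp_inv in Hs, Hs'. destruct Hs as (w & Hw & Hs), Hs' as (w' & Hw' & Hs').
  apply ev_pair_inv in Hw, Hw'.
  destruct Hw as (z & q & Hz & Hq & ->), Hw' as (z' & q' & Hz' & Hq' & ->).
  apply HL' in Hz, Hz'. apply HQ in Hq, Hq'. rewrite <- Ex in Hz'.
  rewrite <- (ev_inj _ _ _ _ _ Hz Hz') in Hs'.
  rewrite (ev_inj _ _ _ _ _ Hq (ev_id O _)) in Hs.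
  rewrite (ev_inj _ _ _ _ _ Hq' (ev_id O _)) in Hs'.
  do 2 f_equal. f_equal. eapply Hd1; [exact Hs|exact Hs'|]. now exists tl. }
exists (c1 + 1 + c2). intros x y z Hz.
destruct (Kn_spec u no_aux x Hu) as [(p & Hp & Hpx) _].
set (K := Kn u no_aux) in *.
(* A single term of the sum in [coding_sum] gives this; it makes the truncated subtraction in [req]
   exact. *)
assert (Hle : forall y, K z <= K (npair z y) + c1).
{ intros y'. destruct (le_lt_dec (K z) (K (npair z y') + c1)) as [|Hlt]; [assumption|].
  pose proof (Hc1 z (S y')) as H.
  pose proof (rsum_term (S y') (fun y => half (K (npair z y) + c1)) y') as Ht.
  cbv beta in Ht. specialize (Ht (fun j _ => Rlt_le _ _ (half_pos _)) ltac:(lia)).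
  pose proof (half_le (S (K (npair z y') + c1)) (K z) Hlt) as H2. rewrite half_S in H2.
  pose proof (half_pos (K (npair z y') + c1)). lra. }
destruct (Hd2 (halting_seq u) z (fun y => req (cp z y)) y) as (q & Hq & Hqy).
- intros j _. now apply Hr.
- unfold req. lia.
- apply (Rmult_le_reg_r (half (K z))); [apply half_pos|].
  rewrite Rmult_1_l, Rmult_comm, <- rsum_scal.
  eapply Rle_trans; [|apply (Hc1 z (S y))]. apply rsum_le. intros j _.
  unfold wt, req. rewrite p1_cp, p2_cp. fold K. rewrite Nat.add_1_r. simpl Nat.eqb. cbv iota.
  rewrite half_S. specialize (Hle j).
  replace (K (npair z j) + c1) with (K z + (K (npair z j) + c1 - K z)) at 2 by lia.
  rewrite half_add. lra.
- destruct (Hc2 (halting_seq u) (nat_of_str (str p ++ str q)) (npair x y)) as (s & Hs & Hl).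
  + eapply ev_comp; [exact (Hsp2 _ p q x Hpx)|]. apply Hout. exists y. rewrite !p2_cp. split; [|reflexivity].
    eapply ev_comp; [|exact Hqy]. apply ev_pair.
    * apply HL'. rewrite !p2_cp. now apply HL.
    * apply HQ. rewrite p2_cp, p1_cp. constructor.
  + destruct (Kn_spec u (halting_seq u) (npair x y) Hu) as [_ H]. specialize (H _ Hs).
    unfold len at 2 in Hl. rewrite strK, length_app in Hl. fold (len p) (len q) in Hl.
    unfold req in Hq. rewrite p1_cp, p2_cp in Hq. fold K in Hq, Hp. specialize (Hle y). lia.
Qed.

Theorem theorem3 (u : code) (Hu : universal_pf u)
  (B : list bool -> list bool) (HB : limit_computable B) :
  exists c : Z, forall x y : list bool,
    (Imut u (B x) y < Imut u x y + IH u (pair_str x y) + c)%Z.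
Proof.
destruct HB as (g & Hg & HB).
destruct (Kn_limit u g Hu) as [c Hc].
{ intros x t. destruct (Hg (str x) t) as [y Hy]. unfold out in Hy. rewrite nat_of_strK in Hy.
  eauto. }
(* Where [B x] is empty the machine may diverge, but then the constant machine serves. *)
destruct (Kn_limit u CZero Hu) as [c0 Hc0]; [intros; eexists; constructor|].
(* The sum of the constants covers both cases, and the added 1 makes the inequality strict. *)
exists (Z.of_nat (c + c0) + 1)%Z. intros x y.
assert (H : Kc u (halting_seq u) (pair_str x y) + K u (B x) <= K u x + K u (pair_str (B x) y) + (c + c0)).
{ specialize (Hc (nat_of_str x) (nat_of_str y) (nat_of_str (B x))).
  specialize (Hc0 (nat_of_str x) (nat_of_str y) (nat_of_str (B x))).
  unfold Kn, npair in Hc, Hc0. rewrite !strK in Hc, Hc0. fold (K u (B x)) in Hc, Hc0.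
  unfold K in *. destruct (HB x) as [Hne _].
  destruct (B x) as [|b s].
  - enough (exists t0, forall t, t0 <= t -> ev no_aux CZero (cp (nat_of_str x) t) (nat_of_str [])) by
      (specialize (Hc0 H); lia).
    exists 0. intros. constructor.
  - destruct Hne as [t0 Ht0]; [discriminate|].
    assert (Hlim : exists t0, forall t, t0 <= t -> ev no_aux g (cp (nat_of_str x) t) (nat_of_str (b :: s)))
      by (exists t0; exact Ht0).
    specialize (Hc Hlim). lia. }
unfold Imut, IH. lia.
Qed.
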